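(* If $f\in L^2(\mathbb R^n)$ is non-zero and log-concave, then \[\frac1{\Gamma(\beta+1)^{1/\beta}}\,\mathrm{R}_\beta f\subseteq\frac1{\Gamma(\alpha+1)^{1/\alpha}}\,\mathrm{R}_\alpha f\] for all $-1<\alpha<\beta<\infty$ (where for the index $0$ the factor $\Gamma(\alpha+1)^{1/\alpha}$ is interpreted as its limit $e^{-\gamma}$, $\gamma$ Euler's constant). There is equality if $f(x)=a\,e^{-\Vert x-x_0\Vert_\Delta}$ for $x\in\mathbb R^n$, with $a>0$, $x_0\in\mathbb R^n$ and $\Delta$ an $n$-dimensional simplex having a vertex at the origin.
   Context: Star-shaped sets are described by radial functions $\rho_K$ on $\mathbb S^{n-1}$; $\lambda K$ has radial function $\lambda\rho_K$, and $K\subseteq L$ means $\rho_K\le\rho_L$. $\Vert x\Vert_\Delta=\inf\{\lambda>0:x\in\lambda\Delta\}$. For non-negative non-zero $f\in L^2(\mathbb R^n)$: for $\alpha>0$, $\mathrm{R}_\alpha f$ is the star-shaped set with $\rho_{\mathrm{R}_\alpha f}(\xi)^\alpha=\frac{\alpha}{\Vert f\Vert_2^2}\int_0^\infty t^{\alpha-1}\int_{\mathbb R^n}f(x)f(x+t\xi)\,dx\,dt$; for $-1<\alpha<0$, $\mathrm{R}_\alpha f$ is the star-shaped set with $\rho_{\mathrm{R}_\alpha f}(\xi)^\alpha=\frac{|\alpha|}{2\Vert f\Vert_2^2}\int_0^\infty t^{\alpha-1}\int_{\mathbb R^n}|f(x+t\xi)-f(x)|^2\,dx\,dt$; and $\log\rho_{\mathrm{R}_0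 f}(\xi)=-\gamma+\int_0^\infty\frac1t\big(\frac1{\Vert f\Vert_2^2}\int_{\mathbb R^n}f(x)f(x+t\xi)\,dx-e^{-t}\big)\,dt$, with $\gamma$ Euler's constant. A log-concave function is one whose logarithm is concave with values in $[-\infty,\infty)$. *)

(* Defs.v *)
From HB Require Import structures.
From mathcomp Require Import all_boot all_order all_algebra.
From mathcomp Require Import all_classical all_reals all_analysis.
Set Implicit Arguments. Unset Strict Implicit. Unset Printing Implicit Defensive.
Import Order.TTheory GRing.Theory Num.Theory.
Import numFieldNormedType.Exports.
Local Open Scope classical_set_scope.
Local Open Scope ring_scope.

Section Defs.
Variable R : realType.

(* Lebesgue integral over R^n of a non-negative (extended-real) function,
   computed as an iterated integral of one-dimensional Lebesgue integrals
   (Tonelli).  Coordinate 0 is integrated outermost. *)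
Fixpoint iint (n : nat) : ('rV[R]_n -> \bar R) -> \bar R :=
  match n with
  | 0 => fun g => g 0
  | n'.+1 => fun g =>
      (\int[@lebesgue_measure R]_(x in [set: R])
         iint (fun v : 'rV[R]_n' => g (row_mx (const_mx x : 'rV[R]_1) v)))%E
  end.

Definition sphere (n : nat) : set 'rV[R]_n :=
  [set xi | \sum_(i < n) xi ord0 i ^+ 2 = 1].

Definition log_concave (n : nat) (f : 'rV[R]_n -> R) : Prop :=
  exists phi : 'rV[R]_n -> \bar R,
    (forall x, phi x != +oo%E) /\
    (forall x y (l : R), 0 < l < 1 ->
       (l%:E * phi x + (1 - l)%:E * phi y <= phi (l *: x + (1 - l) *: y)%R)%E) /\
    (forall x, (f x)%:E = expeR (phi x)).

Definition L2sq (n : nat) (f : 'rV[R]_n -> R) : \bar R :=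
  iint (fun x => (f x ^+ 2)%:E).

Definition gcov (n : nat) (f : 'rV[R]_n -> R) (xi : 'rV[R]_n) (t : R) : \bar R :=
  iint (fun x => (f x * f (x + t *: xi))%:E).

Definition gdiff (n : nat) (f : 'rV[R]_n -> R) (xi : 'rV[R]_n) (t : R) : \bar R :=
  iint (fun x => ((f (x + t *: xi) - f x) ^+ 2)%:E).

Definition epow (x : \bar R) (p : R) : \bar R :=
  match x with
  | r%:E => if r == 0 then (if 0 < p then 0%E else +oo%E) else (powR r p)%:E
  | +oo%E => if 0 < p then +oo%E else 0%E
  | -oo%E => 0%E
  end.

Definition euler_gamma : R :=
  limn (fun n : nat => \sum_(1 <= k < n.+1) (k%:R)^-1 - ln (n%:R : R)).

Definition Gamma (s : R) : R :=
  fine (\int[@lebesgue_measure R]_(t in `]0%R, +oo[%classic)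
          ((powR t (s - 1)) * expR (- t))%:E)%E.

(* Gamma(alpha+1)^(1/alpha), extended by continuity with e^{-gamma} at 0 *)
Definition Gfac (a : R) : R :=
  if a == 0 then expR (- euler_gamma) else powR (Gamma (a + 1)) a^-1.

(* radial function of the radial mean body R_a f, evaluated at xi *)
Definition rho (n : nat) (a : R) (f : 'rV[R]_n -> R) (xi : 'rV[R]_n) : \bar R :=
  let nf := fine (L2sq f) in
  if 0 < a then
    epow ((a / nf)%:E *
          \int[@lebesgue_measure R]_(t in `]0%R, +oo[%classic)
             ((powR t (a - 1))%:E * gcov f xi t))%E a^-1
  else if a < 0 then
    epow ((`|a| / (2 * nf))%:E *
          \int[@lebesgue_measure R]_(t in `]0%R, +oo[%classic)
             ((powR t (a - 1))%:E * gdiff f xi t))%E a^-1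
  else
    match (\int[@lebesgue_measure R]_(t in `]0%R, +oo[%classic)
             (t^-1 * (fine (gcov f xi t) / nf - expR (- t)))%:E)%E with
    | r%:E => (expR (- euler_gamma + r))%:E
    | +oo%E => +oo%E
    | -oo%E => 0%E
    end.

(* n-dimensional simplex with a vertex at the origin: the other vertices
   are the rows of the invertible matrix V. *)
Definition simplex0 (n : nat) (V : 'M[R]_n) : set 'rV[R]_n :=
  [set y | exists lam : 'rV[R]_n,
     (forall i, 0 <= lam ord0 i) /\ \sum_(i < n) lam ord0 i <= 1 /\ y = lam *m V].

(* gauge ||x||_D = inf {l > 0 : x in l D}  (inf of the empty set = +oo) *)
Definition gauge (n : nat) (D : set 'rV[R]_n) (x : 'rV[R]_n) : \bar R :=
  ereal_inf [set l%:E | l in [set l : R | 0 < l /\ exists2 y, D y & x = l *: y]].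

End Defs.

(* Main.v *)
(** The normalized covariogram g(t) = |f|^-2 int f(x) f(x + t xi) dx is even,
    log-concave in t (Prekopa-Leindler) and g(0) = 1, and
    int |f(x + t xi) - f(x)|^2 dx = 2 |f|^2 (1 - g(t)), so that all the bodies
    R_a f are given in the direction xi by integrals of g against t^(a-1). For
    g(t) = e^(-t/s) the normalized radius is s for every a. Given s below the
    normalized radius at b, compare g with h(t) = e^(-t/s): as log g is concave,
    log h linear and both vanish at 0, the difference g - h changes sign at most
    once, at t0 say, from + to -. Multiplying by t^(a-b), which decreases, shows
    that int t^(b-1) (g - h) >= 0 implies int t^(a-1) (g - h) >= 0, that is, the
    normalized radius at a is at least s. For f(x) = c e^(-|x - x0|) with the
    gauge of a simplex, g(t) is exactly e^(-kt).

    A log-concave function need not be Borel measurable on R^n, but its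
    one-dimensional slices have intervals as superlevel sets, and so do, by
    Prekopa-Leindler, its marginals: every iterated integral is that of a
    measurable function. *)

Require Import Defs.
From HB Require Import structures.
From mathcomp Require Import all_boot all_order all_algebra.
From mathcomp Require Import all_classical all_reals all_analysis.
From mathcomp Require Import measurable_realfun ring lra.
Set Implicit Arguments. Unset Strict Implicit. Unset Printing Implicit Defensive.
Import Order.TTheory GRing.Theory Num.Theory.
Import numFieldNormedType.Exports.
Local Open Scope classical_set_scope.
Local Open Scope ring_scope.

(** * Tools on the real line *)

(** Two kinds of infinity shape the argument. A marginal of a log-concave function may take the
    value +oo, so the Prekopa-Leindler inequality is stated for extended-valued functions. The
    integrals that define the radii of a general [profile] may be infinite and, at order 0, have no
    sign. Radii are therefore not compared directly: a lower bound s on a normalized radius becomes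
    the integral inequality [above a s g], and then, with P and N the positive and negative parts of
    g - h, a comparison of two weighted integrals of the non-negative functions N and P. The
    constants Gamma(a+1)^(1/a) enter through h alone. Writing e^(-t/s) as the integral of its
    density over the tail, Tonelli evaluates its integrals against |a| t^(a-1), for either sign of
    a, as the moment of order a of the exponential law of mean s; at order 0, Frullani's integral
    gives ln s. The bound s is taken strictly below the radius at b: this excludes the case where g
    never exceeds h, in which there would be no crossing point. *)

Section OneDimensional.
Variable R : realType.
Local Notation mu := (@lebesgue_measure R).

(** The integral of a non-negative function is a supremum over the simple functions below it, which
    is monotone even for functions not known to be measurable. *)
Lemma le_integral_setT (f g : R -> \bar R) : (forall x, 0 <= f x)%E ->
  (forall x, f x <= g x)%E -> (\int[mu]_x f x <= \int[mu]_x g x)%E.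
Proof.
move=> f0 fg; rewrite !ge0_integralTE//; last first.
  by move=> x; exact: le_trans (fg x).
apply: le_ereal_sup => _ [h hf <-]; exists h => //.
by move=> x; exact: le_trans (fg x).
Qed.

Lemma lebesgue_measure_shift (c : R) (A : set R) : measurable A ->
  pushforward mu (fun x => x + c : measurableTypeR R) A = mu A.
Proof.
move=> mA; have mf : measurable_fun [set: measurableTypeR R]
    (fun x => x + c : measurableTypeR R) by exact: measurable_funD.
pose phi : {mfun measurableTypeR R >-> measurableTypeR R} :=
  HB.pack (fun x => x + c : measurableTypeR R)
    (isMeasurableFun.Build _ _ _ _ _ mf).
apply/esym; apply: (@lebesgue_measure_unique _ (pushforward mu phi)) => //.
move=> _ [[a b]] _ <-; rewrite /= /pushforward.
rewrite (_ : _ @^-1` _ = `]a - c, b - c]%classic); last first.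
  by apply/seteqP; split => x /=; rewrite !in_itv/= ltrBlDr lerBrDr.
by rewrite !lebesgue_measure_itv/= !lte_fin ltrD2r -!EFinB;
  case: ifP => // _; congr EFin; lra.
Qed.

Lemma ge0_integral_shift (c : R) (f : R -> \bar R) :
  measurable_fun setT f -> (forall x, 0 <= f x)%E ->
  (\int[mu]_(x in [set: R]) f (x + c)%R = \int[mu]_x f x)%E.
Proof.
move=> mf f0; have mphi : measurable_fun [set: measurableTypeR R]
    (fun x => x + c : measurableTypeR R) by exact: measurable_funD.
rewrite -[LHS](@ge0_integral_pushforward _ _ _ _ _ _ mphi mu setT)//.
apply: eq_measure_integral => A mA _.
exact: lebesgue_measure_shift.
Qed.

Lemma lebesgue_measure_scale (k : R) (A : set R) : 0 < k -> measurable A ->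
  (k%:E * pushforward mu (fun x => (k * x)%R : measurableTypeR R) A = mu A)%E.
Proof.
move=> k0 mA; have mf : measurable_fun [set: measurableTypeR R]
    (fun x => k * x : measurableTypeR R) by exact: measurable_funM.
pose phi : {mfun measurableTypeR R >-> measurableTypeR R} :=
  HB.pack (fun x => k * x : measurableTypeR R)
    (isMeasurableFun.Build _ _ _ _ _ mf).
pose kk := NngNum (ltW k0).
apply/esym; apply: (@lebesgue_measure_unique _ (mscale kk (pushforward mu phi))) => //.
move=> _ [[a b]] _ <-; rewrite /= /mscale /= /pushforward.
rewrite (_ : _ @^-1` _ = `]a / k, b / k]%classic); last first.
  by apply/seteqP; split => x /=; rewrite !in_itv/= ltr_pdivrMr// ler_pdivlMr// (mulrC k).
rewrite !lebesgue_measure_itv/= !lte_fin ltr_pM2r ?invr_gt0// -!EFinB.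
case: ifP => // _; last by rewrite mule0.
by rewrite -EFinM; congr EFin; field; rewrite gt_eqF.
Qed.

Lemma ge0_integral_scale (k : R) (f : R -> \bar R) : 0 < k ->
  measurable_fun setT f -> (forall x, 0 <= f x)%E ->
  (k%:E * \int[mu]_(x in `]0%R, +oo[) f (k * x)%R = \int[mu]_(x in `]0%R, +oo[) f x)%E.
Proof.
move=> k0 mf f0; have mphi : measurable_fun [set: measurableTypeR R]
    (fun x => k * x : measurableTypeR R) by exact: measurable_funM.
have D : `]0%R, +oo[%classic = (fun x => k * x) @^-1` `]0%R, +oo[%classic :> set R.
  by apply/seteqP; split => x /=; rewrite !in_itv/= !andbT pmulr_rgt0.
rewrite (_ : integral mu _ _ =
    integral (pushforward mu (fun x => k * x : measurableTypeR R)) `]0%R, +oo[%classic f);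
  last first.
  by rewrite (ge0_integral_pushforward mphi)// -?D//; exact: measurable_funTS.
pose phi : {mfun measurableTypeR R >-> measurableTypeR R} :=
  HB.pack (fun x => k * x : measurableTypeR R)
    (isMeasurableFun.Build _ _ _ _ _ mphi).
pose kk := NngNum (ltW k0).
rewrite -[k]/(kk%:num) -ge0_integral_mscale//; last exact: measurable_funTS.
by apply: eq_measure_integral => A mA _; exact: lebesgue_measure_scale.
Qed.

(** Tonelli on the region below the graph. Truncating at a and measuring levels as fractions r of a
    puts all level integrals on ]0,1[, where functions truncated at different heights can be
    compared at the same r. *)
Lemma layer_cake_min (a : R) (F : R -> \bar R) : 0 < a ->
  measurable_fun setT F -> (forall x, 0 <= F x)%E ->
  (a%:E * \int[mu]_(r in `]0%R, 1%R[) mu [set x | (r * a)%:E <= F x]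
   = \int[mu]_x mine (F x) a%:E)%E.
Proof.
move=> a0 mF F0.
pose S := [set p : measurableTypeR R * measurableTypeR R |
  `]0%R, 1%R[%classic p.2 /\ ((p.2 * a)%:E <= F p.1)%E].
have mS : measurable S.
  rewrite (_ : S = (snd @^-1` `]0%R, 1%R[%classic) `&`
      [set p | (0 <= F p.1 - (p.2 * a)%:E)%E]); last first.
    by apply/seteqP; split => -[x r]/=; rewrite /S/= ?EFinN sube_ge0//.
  apply: measurableI.
    by rewrite -[X in measurable X]setTI; exact: measurable_snd.
  rewrite -[X in measurable X]setTI; apply: emeasurable_fun_c_infty => //.
  apply: emeasurable_funB; first exact: measurableT_comp.
  by apply/measurable_EFinP; exact: measurable_funM.
pose f (p : measurableTypeR R * measurableTypeR R) := ((\1_S p : R)%:E).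
have mf : measurable_fun setT f.
  by apply/measurable_EFinP; exact: measurable_indic.
have f0 p : (0 <= f p)%E by rewrite lee_fin.
have Hr r : (\int[mu]_x f (x, r) =
    (fun r => mu [set x | ((r * a)%:E <= F x)%E]) \_ `]0%R, 1%R[ r)%E.
  rewrite patchE; case: ifPn => [/set_mem r01|].
    have mA : measurable [set x | ((r * a)%:E <= F x)%E].
      by rewrite -[X in measurable X]setTI; exact: emeasurable_fun_c_infty.
    rewrite -[[set x | _]]setIT -integral_indic//.
    apply: eq_integral => x _; rewrite /f /S; congr EFin; rewrite !indicE.
    congr (nat_of_bool _)%:R; apply/idP/idP; rewrite !inE/=.
      by case.
    by move=> h; split.
  move/negP => r01; rewrite integral0_eq// => x _.
  rewrite /f indicE memNset//= => -[h _]; apply: r01; exact/mem_set.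
(* The vertical section over x has length min(1, F x / a). *)
have Hx x : (a%:E * \int[mu]_r f (x, r) = mine (F x) a%:E)%E.
  have [aF|Fa] := leP a%:E (F x).
    rewrite (_ : (fun r => f (x, r)) = (fun r => (\1_(`]0%R, 1%R[%classic) r)%:E)).
      by rewrite integral_indic// setIT /= lebesgue_measure_itv/= lte_fin ltr01 sube0 mule1.
    apply/funext => r; rewrite /f !indicE; congr ((nat_of_bool _)%:R%:E).
    apply/idP/idP; rewrite !inE/=; first by case.
    move=> h; split => //; apply: le_trans aF; rewrite lee_fin.
    by move: h; rewrite in_itv/= => /andP[h1 h2]; rewrite ger_pMl// ltW.
  have Ffin : F x \is a fin_num by rewrite ge0_fin_numE// (lt_trans Fa)// ltry.
  set y := fine (F x); have yE : F x = y%:E by rewrite fineK.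
  have ya : y < a by rewrite -lte_fin -yE.
  have y0 : 0 <= y by rewrite -lee_fin -yE.
  rewrite (_ : (fun r => f (x, r)) = (fun r => (\1_(`]0%R, y / a]%classic) r)%:E)).
    rewrite integral_indic// setIT /= lebesgue_measure_itv/= lte_fin yE sube0.
    case: ifPn => [_|]; first by rewrite -EFinM mulrC divfK// gt_eqF.
    rewrite -leNgt => ya0; have := y0; rewrite le_eqVlt => /predU1P[<-|y1].
      by rewrite mule0.
    by move: ya0; rewrite leNgt divr_gt0.
  apply/funext => r; rewrite /f !indicE; congr ((nat_of_bool _)%:R%:E).
  apply/idP/idP; rewrite !inE/= /S/= yE lee_fin !in_itv/=.
    by move=> [/andP[r0 r1] ra]; rewrite r0 ler_pdivlMr.
  move=> /andP[r0]; rewrite ler_pdivlMr// => ra; split => //.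
  by rewrite r0 -(ltr_pM2r a0) mul1r (le_lt_trans ra).
rewrite [X in (_ * X)%E]integral_mkcond.
under [X in (_ * X)%E]eq_integral do rewrite -Hr.
rewrite -(fubini_tonelli f)//.
rewrite -ge0_integralZl//; last 3 first.
- exact: (measurable_fun_fubini_tonelli_F f).
- by move=> x _; exact: integral_ge0.
- by rewrite lee_fin ltW.
by apply: eq_integral => x _; rewrite Hx.
Qed.

End OneDimensional.

(** * The Prekopa-Leindler inequality *)

Section PrekopaLeindler1.
Variable R : realType.
Local Notation mu := (@lebesgue_measure R).

(* The Prekopa-Leindler condition F(x)^l G(y)^(1-l) <= H(l x + (1-l) y), stated
   through real minorants u, v so as to avoid powers of extended reals. *)
Definition pl_le (V : lmodType R) (l : R) (F G H : V -> \bar R) : Prop :=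
  forall (x y : V) (u v : R), 0 < u -> 0 < v ->
    (u%:E <= F x)%E -> (v%:E <= G y)%E ->
    ((u `^ l * v `^ (1 - l))%:E <= H (l *: x + (1 - l) *: y)%R)%E.

(** Log-concavity with +oo allowed as a value, so that the class is closed under taking
    marginals. *)
Definition elc (V : lmodType R) (F : V -> \bar R) : Prop :=
  (forall x, 0 <= F x)%E /\ (forall l, 0 < l < 1 -> pl_le l F F F).

Lemma measurable_interval_levels (f : R -> \bar R) :
  (forall r : R, is_interval [set x | (r%:E <= f x)%E]) -> measurable_fun setT f.
Proof.
move=> If; apply: (measurability _ (ErealGenCInfty.measurableE R)) => //.
move=> _ [_ [r ->] <-]; rewrite setTI.
apply: is_interval_measurable => x y; rewrite /= !in_itv/= !andbT.
by move=> fx fy z xzy; rewrite in_itv/= andbT; exact: If xzy.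
Qed.

(** With both minorants equal to r, the geometric mean r^l r^(1-l) is r again. *)
Lemma elc_level (F : R^o -> \bar R) (r : R) : elc F ->
  is_interval [set x : R | (r%:E <= F x)%E].
Proof.
move=> [F0 LF] x y /= Fx Fy z /andP[xz zy].
have [r0|r0] := leP r 0.
  by apply: le_trans (F0 z); rewrite lee_fin.
have := xz; rewrite le_eqVlt => /predU1P[<-//|xz'].
have := zy; rewrite le_eqVlt => /predU1P[->//|zy'].
have yx : 0 < y - x by lra.
pose l := (y - z) / (y - x).
have l0 : 0 < l by rewrite divr_gt0//; lra.
have l1 : l < 1 by rewrite ltr_pdivrMr//; lra.
have := LF l _ x y r r r0 r0 Fx Fy; rewrite l0 l1 => /(_ isT).
rewrite -powRD; last by rewrite (gt_eqF r0) implybT.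
rewrite [l + _]addrC subrK powRr1 ?(ltW r0)// .
suff -> : z = l * x + (1 - l) * y by [].
by rewrite /l; field; rewrite gt_eqF.
Qed.

Lemma elc_measurable (F : R^o -> \bar R) : elc F ->
  measurable_fun [set: R] F.
Proof. by move=> LF; apply: measurable_interval_levels => r; exact: elc_level. Qed.

(** The measure of the superlevel set decreases in r, so its own superlevel sets are intervals. *)
Lemma measurable_level_measure (F : R -> \bar R) (a : R) : 0 < a ->
  measurable_fun setT F ->
  measurable_fun setT (fun r : R => mu [set x | ((r * a)%:E <= F x)%E]).
Proof.
move=> a0 mF; apply: measurable_interval_levels => t x y /= tx ty z /andP[xz zy].
apply: le_trans ty _; apply: le_measure.
- by rewrite inE -[X in measurable X]setTI; exact: emeasurable_fun_c_infty.
- by rewrite inE -[X in measurable X]setTI; exact: emeasurable_fun_c_infty.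
- by move=> w /=; apply: le_trans; rewrite lee_fin ler_pM2r.
Qed.

(** If all differences in A were below d, then A would lie in [inf A, inf A + d]. The points p and q
    stand in for the endpoints of A, which need not belong to it or be finite. *)
Lemma diameter_ge_measure (A : set R) (d : R) : A !=set0 -> measurable A ->
  (d%:E < mu A)%E -> exists p q, [/\ A p, A q, p <= q & d <= q - p].
Proof.
move=> [a0 Aa0] mA dA; apply: contrapT => H.
have {}H p q : A p -> A q -> p <= q -> q - p < d.
  by move=> Ap Aq pq; rewrite ltNge; apply/negP => dpq; apply: H; exists p, q.
have d0 : 0 < d by rewrite -(subrr a0) H.
have lbA q : A q -> lbound A (q - d).
  move=> Aq p Ap; have [pq|qp] := leP p q; last by lra.
  by have := H _ _ Ap Aq pq; lra.
have : (mu A <= mu `[inf A, (inf A + d)%R]%classic)%E.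
  apply: le_measure; rewrite ?inE// => q Aq /=; rewrite in_itv/=; apply/andP; split.
    by apply: ge_inf => //; exists (a0 - d); exact: lbA.
  rewrite -lerBlDr; apply: lb_le_inf; [by exists a0|exact: lbA].
rewrite lebesgue_measure_itv/= lte_fin ltrDl d0 -EFinB addrAC subrr add0r.
by move=> /(lt_le_trans dA); rewrite ltxx.
Qed.

(** Young's inequality for x^l and y^(1-l), with conjugate exponents 1/l and 1/(1-l). *)
Lemma weighted_amgm (l x y : R) : 0 < l < 1 -> 0 < x -> 0 < y ->
  x `^ l * y `^ (1 - l) <= l * x + (1 - l) * y.
Proof.
move=> /andP[l0 l1] x0 y0; have l1' : 0 < 1 - l by lra.
have := @conjugate_powR R (x `^ l) (y `^ (1 - l)) l^-1 (1 - l)^-1.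
rewrite !powR_ge0 !invr_gt0 !invrK => /(_ isT isT l0 l1').
rewrite addrC subrK => /(_ erefl); rewrite -!powRrM !divff ?gt_eqF//.
by rewrite !powRr1 ?(ltW x0) ?(ltW y0)// ![_ * l]mulrC ![_ * (1 - l)]mulrC.
Qed.

Lemma seq_max (x : R) (s : seq R) :
  exists2 m, m \in x :: s & forall y, y \in x :: s -> y <= m.
Proof.
elim: s x => [|z s IH] x.
  by exists x; rewrite ?mem_seq1// => y; rewrite mem_seq1 => /eqP ->.
have [m ms Hm] := IH z; have [xm|mx] := leP x m.
  exists m; first by rewrite inE ms orbT.
  by move=> y; rewrite inE => /predU1P[->//|]; exact: Hm.
exists x; first exact: mem_head.
move=> y; rewrite inE => /predU1P[->//|/Hm ym]; exact: le_trans ym (ltW mx).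
Qed.

Import HBNNSimple.

(** Take a simple function h below F with integral above u, and let a be its maximum: h also lies
    below min(F, a). As the maximum is attained, F reaches the height a, which keeps the level sets
    up to that height non-empty. *)
Lemma truncation (F : R -> \bar R) (u : R) : 0 < u -> (forall x, 0 <= F x)%E ->
  (u%:E < \int[mu]_x F x)%E ->
  exists a : R, [/\ 0 < a, exists x, (a%:E <= F x)%E
    & (u%:E < \int[mu]_x mine (F x) a%:E)%E].
Proof.
move=> u0 F0; rewrite ge0_integralTE// => /ereal_sup_gt[_ [h /= hF <-]].
rewrite -integralT_nnsfun => uh.
have /finite_seqP[s Es] := @fimfunP _ _ h.
have [m ms Hm] := seq_max (h point) s.
have hm x : h x <= m.
  by apply: Hm; rewrite inE; apply/orP; right; have : range h (h x) by []; rewrite Es.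
have [x0 hx0] : exists x, h x = m.
  move: ms; rewrite inE => /predU1P[->|ms]; first by exists point.
  by have : [set` s] m by []; rewrite -Es => -[x _ <-]; exists x.
exists m; split.
- rewrite ltNge; apply/negP => m0; move: uh; rewrite integral0_eq.
    by rewrite lte_fin ltNge ltW.
  move=> x _; congr EFin; apply/eqP; rewrite eq_le fun_ge0 andbT.
  exact: le_trans (hm x) m0.
- by exists x0; rewrite -hx0.
- apply: lt_le_trans uh _; apply: le_integral_setT => x.
    by rewrite lee_fin fun_ge0.
  by rewrite le_min hF lee_fin hm.
Qed.

(** Brunn-Minkowski on the line. If p, q in A and p', q' in B nearly realize the measures as q - p
    and q' - p', then C contains the segment from l p + (1-l) p' to l q + (1-l) q', whose length is
    the same combination. *)
Lemma interval_sum_measure (l : R) (A B C : set R) : 0 < l < 1 ->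
  A !=set0 -> B !=set0 -> measurable A -> measurable B -> measurable C ->
  is_interval C -> (forall x y, A x -> B y -> C (l * x + (1 - l) * y)) ->
  (l%:E * mu A + (1 - l)%:E * mu B <= mu C)%E.
Proof.
move=> /andP[l0 l1] A0 B0 mA mB mC iC ABC; have l1' : 0 < 1 - l by lra.
have key a b : (a%:E < mu A)%E -> (b%:E < mu B)%E ->
    ((l * a + (1 - l) * b)%:E <= mu C)%E.
  move=> /(diameter_ge_measure A0 mA)[p [q [Ap Aq pq aqp]]].
  move=> /(diameter_ge_measure B0 mB)[p' [q' [Bp Bq pq' bqp]]].
  have : (mu `[(l * p + (1 - l) * p')%R, (l * q + (1 - l) * q')%R]%classic <= mu C)%E.
    apply: le_measure; rewrite ?inE// => z /=; rewrite in_itv/= => /andP[h1 h2].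
    by apply: (iC _ _ (ABC _ _ Ap Bp) (ABC _ _ Aq Bq)); rewrite h1 h2.
  apply: le_trans; rewrite lebesgue_measure_itv/= lte_fin.
  have h1 : l * a <= l * (q - p) by rewrite ler_pM2l.
  have h2 : (1 - l) * b <= (1 - l) * (q' - p') by rewrite ler_pM2l.
  by case: ltP => h3; rewrite -?EFinB lee_fin; lra.
(* A minorant available for every set: [key] with b = -1 bounds mu A, hence makes it finite, before
   anything is known on mu B. *)
have neg (S : set R) : ((-1)%:E < mu S)%E.
  by apply: lt_le_trans (measure_ge0 _ _); rewrite lte_fin; lra.
have [mCy|] := eqVneq (mu C) +oo%E; first by rewrite mCy leey.
rewrite -ltey -ge0_fin_numE// => /fineK; move: (fine _) => m mE.
rewrite -{}mE in key *.
have fin (S : set R) (z : R) : (forall a, (a%:E < mu S)%E -> a <= z) ->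
    mu S \is a fin_num /\ fine (mu S) <= z.
  move=> h; have Sz : (mu S <= z%:E)%E.
    rewrite leNgt; apply/negP; case E : (mu S) => [s||]//.
      rewrite lte_fin => zs; have := h ((z + s) / 2); rewrite E lte_fin => h'.
      have hh : (z + s) / 2 < s by lra.
      by have := h' hh; lra.
    by move=> _; have := h (z + 1); rewrite E ltry => /(_ isT); lra.
  have fS : mu S \is a fin_num by rewrite ge0_fin_numE// (le_lt_trans Sz)// ltry.
  by split => //; rewrite -lee_fin fineK.
have hA b : (b%:E < mu B)%E -> mu A \is a fin_num /\ fine (mu A) <= (m - (1 - l) * b) / l.
  move=> bB; apply: fin => a aA; rewrite ler_pdivlMr//.
  by have := key a b aA bB; rewrite lee_fin; lra.
have [fA _] := hA _ (neg B).
have [fB hB] : mu B \is a fin_num /\ fine (mu B) <= (m - l * fine (mu A)) / (1 - l).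
  apply: fin => b bB; have [_] := hA b bB.
  by rewrite ler_pdivlMr// ler_pdivlMr//; lra.
rewrite -(fineK fA) -(fineK fB) -!EFinM -EFinD lee_fin.
by move: hB; rewrite ler_pdivlMr//; lra.
Qed.

(** Truncate F and G at attained heights a and b, and H at c = a^l b^(1-l). For each r in ]0,1[ the
    level sets at r a, r b and r c satisfy Brunn-Minkowski; integrating over r bounds the integral
    of H below by c (l u/a + (1-l) v/b), and the weighted arithmetic-geometric inequality turns this
    into u^l v^(1-l). *)
Lemma prekopa_leindler1_lt (l u v : R) (F G H : R^o -> \bar R) : 0 < l < 1 ->
  elc F -> elc G -> elc H -> pl_le l F G H -> 0 < u -> 0 < v ->
  (u%:E < \int[mu]_x F x)%E -> (v%:E < \int[mu]_x G x)%E ->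
  ((u `^ l * v `^ (1 - l))%:E <= \int[mu]_x H x)%E.
Proof.
move=> l01 LF LG LH FGH u0 v0.
have [l0 l1] := andP l01; have l1' : 0 < 1 - l by lra.
have [mF mG mH] : [/\ measurable_fun [set: R] F, measurable_fun [set: R] G
    & measurable_fun [set: R] H] by split; exact: elc_measurable.
move=> /(truncation u0 LF.1)[a [a0 [xa Fxa] uF]].
move=> /(truncation v0 LG.1)[b [b0 [yb Gyb] vG]].
set c := a `^ l * b `^ (1 - l).
have c0 : 0 < c by rewrite mulr_gt0// powR_gt0.
have mA (K : R -> \bar R) (d r : R) : measurable_fun [set: R] K ->
    measurable [set x | ((r * d)%:E <= K x)%E].
  by move=> mK; rewrite -[X in measurable X]setTI; exact: emeasurable_fun_c_infty.
have level r : r \in `]0, 1[%classic ->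
    (l%:E * mu [set x | ((r * a)%:E <= F x)%E] +
     (1 - l)%:E * mu [set x | ((r * b)%:E <= G x)%E]
     <= mu [set x | ((r * c)%:E <= H x)%E])%E.
  rewrite inE/= in_itv/= => /andP[r0 r1].
  apply: interval_sum_measure => //.
  - by exists xa => /=; apply: le_trans Fxa; rewrite lee_fin ger_pMl// ltW.
  - by exists yb => /=; apply: le_trans Gyb; rewrite lee_fin ger_pMl// ltW.
  - exact: mA.
  - exact: mA.
  - exact: mA.
  - exact: elc_level.
  - move=> x y /= Fx Gy.
    have := FGH x y _ _ (mulr_gt0 r0 a0) (mulr_gt0 r0 b0) Fx Gy.
    congr (_ <= _)%E; congr EFin; rewrite !powRM ?ltW//.
    rewrite mulrACA -powRD; last by rewrite (gt_eqF r0) implybT.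
    by rewrite [l + _]addrC subrK powRr1// ltW.
pose IF := (\int[mu]_(r in `]0%R, 1%R[) mu [set x | ((r * a)%:E <= F x)])%E.
pose IG := (\int[mu]_(r in `]0%R, 1%R[) mu [set x | ((r * b)%:E <= G x)])%E.
have HI : (l%:E * IF + (1 - l)%:E * IG <=
    \int[mu]_(r in `]0%R, 1%R[) mu [set x | ((r * c)%:E <= H x)])%E.
  have ml (K : R -> \bar R) (d : R) : 0 < d -> measurable_fun [set: R] K ->
      measurable_fun (`]0%R, 1%R[%classic : set R)
        (fun r : R => mu [set x | ((r * d)%:E <= K x)%E]).
    by move=> d0 mK; apply: measurable_funTS; exact: measurable_level_measure.
  rewrite -!ge0_integralZl//; try by rewrite lee_fin ltW.
  - rewrite -ge0_integralD//.
    + apply: ge0_le_integral => //.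
      * by move=> r _; rewrite adde_ge0// mule_ge0// lee_fin ltW.
      * by apply: emeasurable_funD; apply: measurable_funeM; exact: ml.
      * exact: ml.
      * by move=> r r01; apply: level; rewrite inE.
    + by move=> r _; rewrite mule_ge0// lee_fin ltW.
    + by apply: measurable_funeM; exact: ml.
    + by move=> r _; rewrite mule_ge0// lee_fin ltW.
    + by apply: measurable_funeM; exact: ml.
  - exact: ml.
  - exact: ml.
apply: (@le_trans _ _ (\int[mu]_x mine (H x) c%:E)%E); last first.
  apply: le_integral_setT => x; last by rewrite ge_min lexx.
  by rewrite le_min LH.1 lee_fin ltW.
rewrite -(layer_cake_min c0 mH LH.1).
apply: (@le_trans _ _ (c%:E * (l%:E * IF + (1 - l)%:E * IG))%E); last first.
  by rewrite lee_pmul2l// lte_fin.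
have uIF : ((u / a)%:E <= IF)%E.
  move: uF; rewrite -(layer_cake_min a0 mF LF.1) -/IF => /ltW.
  by rewrite -{1}(divfK (lt0r_neq0 a0) u) mulrC EFinM lee_pmul2l// lte_fin.
have vIG : ((v / b)%:E <= IG)%E.
  move: vG; rewrite -(layer_cake_min b0 mG LG.1) -/IG => /ltW.
  by rewrite -{1}(divfK (lt0r_neq0 b0) v) mulrC EFinM lee_pmul2l// lte_fin.
apply: (@le_trans _ _ (c * (l * (u / a) + (1 - l) * (v / b)))%:E).
  rewrite lee_fin.
  have -> : u `^ l * v `^ (1 - l) = c * ((u / a) `^ l * (v / b) `^ (1 - l)).
    rewrite /c mulrACA -!powRM ?divr_ge0 ?ltW//.
    by rewrite ![_ * (_ / _)]mulrC !divfK ?gt_eqF.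
  by rewrite ler_pM2l// weighted_amgm// divr_gt0.
rewrite EFinM lee_pmul2l ?lte_fin// EFinD !EFinM.
by apply: leeD; rewrite lee_pmul2l ?lte_fin.
Qed.

(* Rescaling both minorants by a factor below 1 removes the strictness. *)
Lemma prekopa_leindler1 (l u v : R) (F G H : R^o -> \bar R) : 0 < l < 1 ->
  elc F -> elc G -> elc H -> pl_le l F G H -> 0 < u -> 0 < v ->
  (u%:E <= \int[mu]_x F x)%E -> (v%:E <= \int[mu]_x G x)%E ->
  ((u `^ l * v `^ (1 - l))%:E <= \int[mu]_x H x)%E.
Proof.
move=> l01 LF LG LH FGH u0 v0 uF vG.
have scaled d : 0 < d < 1 -> ((d * (u `^ l * v `^ (1 - l)))%:E <= \int[mu]_x H x)%E.
  move=> /andP[d0 d1].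
  have -> : d * (u `^ l * v `^ (1 - l)) = (d * u) `^ l * (d * v) `^ (1 - l).
    rewrite !powRM ?ltW// mulrACA -powRD; last by rewrite (gt_eqF d0) implybT.
    by rewrite [l + _]addrC subrK powRr1// ltW.
  apply: (prekopa_leindler1_lt l01 LF LG LH FGH); rewrite ?mulr_gt0//.
    by apply: lt_le_trans uF; rewrite lte_fin gtr_pMl.
  by apply: lt_le_trans vG; rewrite lte_fin gtr_pMl.
have [Hy|] := eqVneq (\int[mu]_x H x)%E +oo%E; first by rewrite Hy leey.
rewrite -ltey -ge0_fin_numE; last by apply: integral_ge0 => x _; exact: LH.1.
move=> /fineK; move: (fine _) => m mE; rewrite -{}mE in scaled *.
set w := u `^ l * v `^ (1 - l) in scaled *.
have w0 : 0 < w by rewrite mulr_gt0 ?powR_gt0.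
rewrite lee_fin leNgt; apply/negP => mw.
have m0 : 0 < m.
  have := scaled (2^-1); rewrite lee_fin => h.
  have h' : 0 < (2^-1 : R) < 1 by apply/andP; split; lra.
  by have := h h'; lra.
(* The midpoint d of m/w and 1 gives d w > m, against [scaled]. *)
have := scaled ((1 + m / w) / 2); rewrite lee_fin => h.
have mw1 : m / w < 1 by rewrite ltr_pdivrMr// mul1r.
have mw0 : 0 < m / w by rewrite divr_gt0.
have hd : 0 < (1 + m / w) / 2 < 1 by apply/andP; split; lra.
have := h hd; have mE : m = m / w * w by rewrite divfK// gt_eqF.
by rewrite {2}mE ler_pM2r//; lra.
Qed.

End PrekopaLeindler1.

(** * Prekopa-Leindler and log-concave marginals for iterated integrals *)

Section Iterated.
Variable R : realType.
Local Notation mu := (@lebesgue_measure R).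

Definition slice n (F : 'rV[R]_n.+1 -> \bar R) (x : R) : 'rV[R]_n -> \bar R :=
  fun v => F (row_mx (const_mx x : 'rV[R]_1) v).

Lemma iintS n (F : 'rV[R]_n.+1 -> \bar R) :
  iint F = (\int[mu]_(x in [set: R]) iint (slice F x))%E.
Proof. by []. Qed.

Lemma iint_ge0 n (F : 'rV[R]_n -> \bar R) : (forall x, 0 <= F x)%E -> (0 <= iint F)%E.
Proof.
elim: n F => [|n IH] F F0; first exact: F0.
by rewrite iintS; apply: integral_ge0 => x _; apply: IH => v; exact: F0.
Qed.

Lemma row_mx_comb n (l m : R) (a b : 'rV[R]_1) (v w : 'rV[R]_n) :
  l *: (row_mx a v : 'rV[R]_n.+1) + m *: (row_mx b w : 'rV[R]_n.+1) =
  row_mx (l *: a + m *: b) (l *: v + m *: w).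
Proof. by rewrite -add_row_mx -!scale_row_mx. Qed.

Lemma pl_le_slice n (l x y : R) (F G H : 'rV[R]_n.+1 -> \bar R) : pl_le l F G H ->
  pl_le l (slice F x) (slice G y) (slice H (l * x + (1 - l) * y)).
Proof.
move=> FGH v w a b a0 b0 Fv Gw; have := FGH _ _ a b a0 b0 Fv Gw.
rewrite /slice row_mx_comb.
suff -> : l *: const_mx x + (1 - l) *: const_mx y =
  const_mx (l * x + (1 - l) * y) :> 'rV[R]_1 by [].
by apply/matrixP => i j; rewrite !mxE.
Qed.

Arguments pl_le_slice {n l} x y {F G H}.

Lemma elc_slice n (x : R) (F : 'rV[R]_n.+1 -> \bar R) : elc F -> elc (slice F x).
Proof.
move=> [F0 LF]; split=> [v|l l01]; first exact: F0.
have := pl_le_slice x x (LF l l01).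
by rewrite -mulrDl [l + _]addrC subrK mul1r.
Qed.

Arguments elc_slice {n} x {F}.

(** Induction on the dimension: the hypothesis applied to slices says that the marginals in the
    outer coordinate satisfy the one-dimensional condition. *)
Lemma prekopa_leindler n (l u v : R) (F G H : 'rV[R]_n -> \bar R) : 0 < l < 1 ->
  elc F -> elc G -> elc H -> pl_le l F G H -> 0 < u -> 0 < v ->
  (u%:E <= iint F)%E -> (v%:E <= iint G)%E ->
  ((u `^ l * v `^ (1 - l))%:E <= iint H)%E.
Proof.
elim: n l u v F G H => [|n IH] l u v F G H l01 LF LG LH FGH u0 v0 /=.
  by move=> uF vG; have := FGH _ _ _ _ u0 v0 uF vG; rewrite !scaler0 addr0.
(* General in the weight and the functions because it serves twice: for F, G, H, and with three
   equal functions and every weight for the log-concavity of each marginal. *)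
have marg m (K1 K2 K3 : 'rV[R]_n.+1 -> \bar R) : 0 < m < 1 ->
    elc K1 -> elc K2 -> elc K3 -> pl_le m K1 K2 K3 ->
    pl_le m (fun x : R^o => iint (slice K1 x)) (fun x : R^o => iint (slice K2 x))
      (fun x : R^o => iint (slice K3 x)).
  move=> m01 L1 L2 L3 K123 x y a b a0 b0 ax by_.
  exact: (IH _ _ _ _ _ _ m01 (elc_slice x L1) (elc_slice y L2) (elc_slice _ L3)
    (pl_le_slice x y K123)).
have emarg (K : 'rV[R]_n.+1 -> \bar R) : elc K -> elc (fun x : R^o => iint (slice K x)).
  move=> LK; split=> [x|m m01]; first by apply: iint_ge0 => w; exact: LK.1.
  by apply: marg => //; exact: LK.2.
apply: prekopa_leindler1 => //.
- exact: (emarg F).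
- exact: (emarg G).
- exact: (emarg H).
- exact: marg.
Qed.

Lemma elc_marginal n (F : 'rV[R]_n.+1 -> \bar R) : elc F ->
  elc (fun x : R^o => iint (slice F x)).
Proof.
move=> LF; split=> [x|l l01 x y a b a0 b0 ax b_y].
  by apply: iint_ge0 => w; exact: LF.1.
exact: (prekopa_leindler l01 (elc_slice x LF) (elc_slice y LF) (elc_slice _ LF)
  (pl_le_slice x y (LF.2 _ l01))).
Qed.

(** Log-concavity supplies the measurability of the marginals that translation invariance on the
    line asks for. *)
Lemma iint_shift n (F : 'rV[R]_n -> \bar R) (w : 'rV[R]_n) : elc F ->
  iint (fun x => F (x + w)) = iint F.
Proof.
elim: n F w => [|n IH] F w LF /=; first by rewrite [in LHS](thinmx0 (0 + w)).
transitivity (\int[mu]_(x in [set: R]) iint (slice F (x + w ord0 ord0)%R))%E.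
  apply: eq_integral => x _.
  rewrite -(IH _ (rsubmx (w : 'rV_(1 + n))) (elc_slice _ LF)).
  congr iint; apply/funext => v; rewrite /slice; congr F.
  apply/matrixP => i j; rewrite !mxE !ord1.
  case: splitP => k jk; rewrite !mxE ?ord1; congr (_ + w _ _); apply/val_inj => //=.
  by rewrite jk ord1.
have LM := elc_marginal LF.
rewrite (@ge0_integral_shift _ _ (fun x => iint (slice F x)))//.
- exact: elc_measurable LM.
- by move=> x; exact: LM.1.
Qed.

(** Superlevel sets are intervals, so two infinite values would make F infinite on the whole segment
    between them. *)
Lemma elc_infinite_unique (F : R^o -> \bar R) : elc F ->
  (\int[mu]_x F x < +oo)%E -> exists p, forall x, F x = +oo%E -> x = p.
Proof.
move=> LF Fi.
have uniq x y : F x = +oo%E -> F y = +oo%E -> x < y -> False.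
  move=> Fx Fy xy; have : (\int[mu]_x F x)%E \is a fin_num.
    by rewrite ge0_fin_numE//; apply: integral_ge0 => z _; exact: LF.1.
  move=> /fineK mE; move: mE Fi; set m := fine _ => mE _.
  have m0 : 0 <= m by rewrite -lee_fin mE; apply: integral_ge0 => z _; exact: LF.1.
  have d0 : 0 < y - x by lra.
  (* The rectangle of height r over [x, y] has area m + 1, more than the integral m. *)
  pose r := (m + 1) / (y - x).
  have r0 : 0 < r by rewrite divr_gt0//; lra.
  have : (\int[mu]_(z in (`[x, y]%classic : set R)) cst r%:E z <= \int[mu]_z F z)%E.
    rewrite integral_mkcond; apply: le_integral_setT => z.
      by apply: erestrict_ge0 => ? _; rewrite lee_fin ltW.
    rewrite patchE; case: ifPn => [|_]; last exact: LF.1.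
    rewrite inE/= in_itv/= => xzy.
    by apply: (elc_level LF _ _ xzy) => /=; rewrite ?Fx ?Fy leey.
  rewrite integral_cst//= lebesgue_measure_itv/= lte_fin xy -EFinB -EFinM -mE lee_fin.
  by rewrite /r divfK ?gt_eqF//; lra.
have [[p Fp]|H] := pselect (exists p, F p = +oo%E); last first.
  by exists 0 => x Fx; exfalso; apply: H; exists x.
exists p => x Fx; have [xp|px|//] := ltgtP x p.
- by case: (uniq _ _ Fx Fp xp).
- by case: (uniq _ _ Fp Fx px).
Qed.

(* D is not log-concave: the measurability of its marginals is deduced from the
   other three terms, outside the at most two points where these are infinite. *)
Lemma iint_additive n (A B K D : 'rV[R]_n -> \bar R) :
  elc A -> elc B -> elc K -> (forall x, 0 <= D x)%E ->
  (forall x, D x + 2%:E * K x = A x + B x)%E ->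
  (iint A < +oo)%E -> (iint B < +oo)%E ->
  (iint D + 2%:E * iint K = iint A + iint B)%E.
Proof.
elim: n A B K D => [|n IH] A B K D LA LB LK D0 DK Ai Bi; first exact: DK.
rewrite !iintS.
have [p Hp] := elc_infinite_unique (elc_marginal LA) Ai.
have [q Hq] := elc_infinite_unique (elc_marginal LB) Bi.
pose MA x := iint (slice A x); pose MB x := iint (slice B x).
pose MK x := iint (slice K x); pose MD x := iint (slice D x).
have mA : measurable_fun [set: R] MA by exact: elc_measurable (elc_marginal LA).
have mB : measurable_fun [set: R] MB by exact: elc_measurable (elc_marginal LB).
have mK : measurable_fun [set: R] MK by exact: elc_measurable (elc_marginal LK).
have MA0 x : (0 <= MA x)%E by apply: iint_ge0 => v; exact: LA.1.
have MB0 x : (0 <= MB x)%E by apply: iint_ge0 => v; exact: LB.1.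
have MK0 x : (0 <= MK x)%E by apply: iint_ge0 => v; exact: LK.1.
have MD0 x : (0 <= MD x)%E by apply: iint_ge0 => v; exact: D0.
have lty (M : R -> \bar R) x r : (M x = +oo%E -> x = r) -> x != r -> (M x < +oo)%E.
  by move=> h /eqP xr; rewrite ltey; apply/eqP => /h.
have off x : x != p -> x != q -> (MD x + 2%:E * MK x = MA x + MB x)%E.
  move=> xp xq; apply: IH.
  - exact: elc_slice.
  - exact: elc_slice.
  - exact: elc_slice.
  - by move=> v; exact: D0.
  - by move=> v; exact: DK.
  - exact: (lty MA x p (Hp x) xp).
  - exact: (lty MB x q (Hq x) xq).
have mD : measurable_fun [set: R] MD.
  rewrite (_ : MD = fun x => if x == p then MD p else if x == q then MD q
      else (MA x + MB x - 2%:E * MK x)%E); last first.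
    apply/funext => x; case: eqVneq => [->//|xp]; case: eqVneq => [->//|xq].
    rewrite -off// addeK// fin_numM// ge0_fin_numE//.
    have : (MA x + MB x < +oo)%E
      by apply: lte_add_pinfty; [exact: (lty _ _ _ (Hp x))|exact: (lty _ _ _ (Hq x))].
    rewrite -off//; apply: le_lt_trans.
    rewrite -[leLHS]add0e leeD// -[leLHS]mul1e lee_wpmul2r// lee_fin; lra.
  apply: measurable_fun_ifT => //.
    exact: measurable_fun_eqr.
  apply: measurable_fun_ifT => //.
    exact: measurable_fun_eqr.
  apply: emeasurable_funB; first exact: emeasurable_funD.
  exact: measurable_funeM.
rewrite -[X in (_ + X)%E]ge0_integralZl//; last by move=> x _; exact: MK0.
rewrite -[LHS]ge0_integralD//; last 3 first.
- by move=> x _; exact: MD0.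
- by move=> x _; apply: mule_ge0 => //; exact: MK0.
- exact: measurable_funeM.
rewrite -[RHS]ge0_integralD//; last 2 first.
- by move=> x _; exact: MA0.
- by move=> x _; exact: MB0.
have mL : measurable_fun [set: R] (fun x => MD x + 2%:E * MK x)%E.
  by apply: emeasurable_funD => //; exact: measurable_funeM.
have mR : measurable_fun [set: R] (fun x => MA x + MB x)%E.
  exact: emeasurable_funD.
have drop (f : R -> \bar R) : measurable_fun [set: R] f ->
    (\int[mu]_x f x = \int[mu]_(x in [set: R] `\ p `\ q) f x)%E.
  move=> mf; rewrite !integral_setD1//.
  - exact: measurableD.
  - exact: measurable_funTS.
  - by apply: measurableD => //; exact: measurableD.
  - exact: measurable_funTS.
rewrite drop// [RHS]drop//.
apply: eq_integral => x; rewrite inE/= => -[[_ xp] xq].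
by apply: off; apply/eqP.
Qed.

End Iterated.

(** * The covariogram of a log-concave function *)

Section Covariogram.
Variable R : realType.
Local Notation mu := (@lebesgue_measure R).

(** Log-concavity of a real function without its logarithm: a zero of f, where the logarithm is -oo,
    is covered because 0 to a positive power is 0. *)
Definition rlc (V : lmodType R) (f : V -> R) : Prop :=
  (forall x, 0 <= f x) /\
  (forall x y l, 0 < l < 1 -> f x `^ l * f y `^ (1 - l) <= f (l *: x + (1 - l) *: y)).

Lemma log_concave_rlc n (f : 'rV[R]_n -> R) : log_concave f -> rlc f.
Proof.
move=> [phi [phiy [phiC fE]]].
have fr x r : phi x = r%:E -> f x = expR r.
  by move=> px; apply/EFin_inj; rewrite fE px.
have f0 x : phi x = -oo%E -> f x = 0.
  by move=> px; apply/EFin_inj; rewrite fE px.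
split=> [x|x y l l01].
  case E : (phi x) => [r| |]; last by rewrite (f0 x).
    by rewrite (fr x r) ?expR_ge0.
  by have := phiy x; rewrite E.
have [l0 l1] := andP l01; have l1' : 0 < 1 - l by lra.
have fpos z : 0 <= f z by rewrite -lee_fin fE expeR_ge0.
case Ex : (phi x) => [r| |]; first last.
- by rewrite (f0 x)// powR0 ?mul0r// gt_eqF.
- by have := phiy x; rewrite Ex.
case Ey : (phi y) => [s| |]; first last.
- by rewrite (f0 y)// powR0 ?mulr0// gt_eqF.
- by have := phiy y; rewrite Ey.
have := phiC x y l l01; rewrite Ex Ey -!EFinM -EFinD.
case Ez : (phi _) => [t| |]; last by [].
  rewrite lee_fin => h; rewrite (fr x r)// (fr y s)// (fr _ t)//.
  by rewrite -!expRM -expRD ler_expR mulrC [s * _]mulrC.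
by have := phiy (l *: x + (1 - l) *: y); rewrite Ez.
Qed.

Lemma comb_id (V : lmodType R) (l : R) (a : V) : l *: a + (1 - l) *: a = a.
Proof. by rewrite -scalerDl [l + _]addrC subrK scale1r. Qed.

(** The product is log-concave jointly in x and the shifts. Equal pairs of shifts give [elc_mul];
    different ones give the log-concavity of the covariogram in t. *)
Lemma pl_le_mul (V : lmodType R) (f : V -> R) (l : R) (a b a' b' : V) :
  rlc f -> 0 < l < 1 ->
  pl_le l (fun x => (f (x + a) * f (x + b))%:E) (fun x => (f (x + a') * f (x + b'))%:E)
    (fun x => (f (x + (l *: a + (1 - l) *: a')) * f (x + (l *: b + (1 - l) *: b')))%:E).
Proof.
move=> [f0 fC] l01 x y u v u0 v0; rewrite !lee_fin => ux vy.
have [l0 l1] := andP l01; have l1' : 0 < 1 - l by lra.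
have combE c c' : l *: x + (1 - l) *: y + (l *: c + (1 - l) *: c') =
    l *: (x + c) + (1 - l) *: (y + c').
  by rewrite !scalerDr addrACA.
rewrite !combE.
apply: (@le_trans _ _ ((f (x + a) * f (x + b)) `^ l *
    (f (y + a') * f (y + b')) `^ (1 - l))).
  apply: ler_pM; rewrite ?powR_ge0//.
  - by apply: ge0_ler_powR ux; rewrite ?nnegrE ?mulr_ge0 ?f0 ?(ltW l0) ?(ltW u0).
  - by apply: ge0_ler_powR vy; rewrite ?nnegrE ?mulr_ge0 ?f0 ?(ltW l1') ?(ltW v0).
rewrite !powRM// mulrACA; apply: ler_pM; rewrite ?mulr_ge0 ?powR_ge0//; exact: fC.
Qed.

(** With two shifts, the norm, the covariogram and all their translates are values of one function,
    invariant under translating both arguments and under exchanging them. *)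
Definition cov n (f : 'rV[R]_n -> R) (a b : 'rV[R]_n) : \bar R :=
  iint (fun x => (f (x + a) * f (x + b))%:E).

Lemma elc_mul n (f : 'rV[R]_n -> R) (a b : 'rV[R]_n) : rlc f ->
  elc (fun x => (f (x + a) * f (x + b))%:E).
Proof.
move=> Lf; split=> [x|l l01]; first by rewrite lee_fin mulr_ge0// Lf.1.
by have := @pl_le_mul _ f l a b a b Lf l01; rewrite !comb_id.
Qed.

Lemma cov_shift n (f : 'rV[R]_n -> R) (a b w : 'rV[R]_n) : rlc f ->
  cov f (a + w) (b + w) = cov f a b.
Proof.
move=> Lf; rewrite /cov -[RHS](iint_shift w (elc_mul a b Lf)).
by congr iint; apply/funext => x; rewrite -!addrA ![w + _]addrC.
Qed.

Lemma covC n (f : 'rV[R]_n -> R) (a b : 'rV[R]_n) : cov f a b = cov f b a.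
Proof. by rewrite /cov; congr iint; apply/funext => x; rewrite mulrC. Qed.

Lemma gcovE n (f : 'rV[R]_n -> R) xi t : gcov f xi t = cov f 0 (t *: xi).
Proof. by rewrite /gcov /cov; congr iint; apply/funext => x; rewrite addr0. Qed.

Lemma L2sqE n (f : 'rV[R]_n -> R) : L2sq f = cov f 0 0.
Proof. by rewrite /L2sq /cov; congr iint; apply/funext => x; rewrite addr0 expr2. Qed.

Lemma gcov_even n (f : 'rV[R]_n -> R) xi t : rlc f -> gcov f xi (- t) = gcov f xi t.
Proof.
move=> Lf; rewrite !gcovE -(@cov_shift _ _ _ _ (t *: xi))//.
by rewrite add0r scaleNr addNr covC.
Qed.

Lemma gcov_log_concave n (f : 'rV[R]_n -> R) xi (l s t u v : R) : rlc f ->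
  0 < l < 1 -> 0 < u -> 0 < v -> (u%:E <= gcov f xi s)%E -> (v%:E <= gcov f xi t)%E ->
  ((u `^ l * v `^ (1 - l))%:E <= gcov f xi (l * s + (1 - l) * t))%E.
Proof.
move=> Lf l01 u0 v0; rewrite !gcovE => us vt.
have := prekopa_leindler l01 (elc_mul _ _ Lf) (elc_mul _ _ Lf) (elc_mul _ _ Lf)
  (@pl_le_mul _ f l 0 (s *: xi) 0 (t *: xi) Lf l01) u0 v0 us vt.
by rewrite !scaler0 addr0 !scalerA -scalerDl.
Qed.

Lemma gcov_ge0 n (f : 'rV[R]_n -> R) xi t : rlc f -> (0 <= gcov f xi t)%E.
Proof. by move=> Lf; apply: iint_ge0 => x; rewrite lee_fin mulr_ge0// Lf.1. Qed.

(** Evenness and log-concavity in place of Cauchy-Schwarz: 0 is the midpoint of t and -t, where the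
    covariogram takes equal values. An infinite value at t would force an infinite norm. *)
Lemma gcov_le n (f : 'rV[R]_n -> R) xi t : rlc f -> (gcov f xi t <= L2sq f)%E.
Proof.
move=> Lf.
have key u : 0 < u -> (u%:E <= gcov f xi t)%E -> (u%:E <= L2sq f)%E.
  move=> u0 ut; have ut' := ut; rewrite -(gcov_even xi t Lf) in ut'.
  have h : 0 < (2^-1 : R) < 1 by apply/andP; split; lra.
  have := gcov_log_concave Lf h u0 u0 ut ut'.
  rewrite -powRD; last by rewrite (gt_eqF u0) implybT.
  rewrite [2^-1 + _]addrC subrK powRr1 ?(ltW u0)// L2sqE gcovE.
  by rewrite (_ : _ * t + _ = 0) ?scale0r//; lra.
have := gcov_ge0 xi t Lf; case E : (gcov f xi t) => [r| |]//.
  rewrite lee_fin le_eqVlt => /predU1P[<-|r0].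
    by apply: iint_ge0 => x; rewrite lee_fin sqr_ge0.
  by apply: key => //; rewrite E.
move=> _; have : forall u, 0 < u -> (u%:E <= L2sq f)%E.
  by move=> u u0; apply: key => //; rewrite E leey.
case: (L2sq f) => [r h| |h]//; last by have := h 1 ltr01.
have := h (`|r| + 1) (ltr_pwDr ltr01 (normr_ge0 r)).
by rewrite lee_fin leNgt (le_lt_trans (ler_norm r))// ltrDl.
Qed.

(** The properties of the normalized covariogram on the half-line from which the radii are compared;
    the last one is concavity of log g on [0, t], where log g vanishes at 0. *)
Definition profile (g : R -> R) : Prop :=
  [/\ g 0 = 1, forall t, 0 <= g t,
      forall s t, 0 <= s -> s <= t -> g t <= g s
    & forall t l, 0 <= t -> 0 < l < 1 -> g t `^ l <= g (l * t)].

Definition ncov n (f : 'rV[R]_n -> R) (xi : 'rV[R]_n) (t : R) : R :=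
  fine (gcov f xi t) / fine (L2sq f).

Section Normalized.
Variables (n : nat) (f : 'rV[R]_n -> R) (xi : 'rV[R]_n).
Hypothesis Lf : rlc f.
Hypothesis f_L2 : (0 < L2sq f < +oo)%E.

Let nf_gt0 : 0 < fine (L2sq f).
Proof. exact: fine_gt0. Qed.

Let L2fin : (fine (L2sq f))%:E = L2sq f.
Proof. by rewrite fineK// ge0_fin_numE ?(andP f_L2).2// ltW// (andP f_L2).1. Qed.

Let gcov_fin t : (fine (gcov f xi t))%:E = gcov f xi t.
Proof.
rewrite fineK// ge0_fin_numE ?gcov_ge0//.
by apply: le_lt_trans (gcov_le _ _ Lf) _; case/andP: f_L2.
Qed.

Lemma gcov_ncov t : gcov f xi t = (fine (L2sq f) * ncov f xi t)%:E.
Proof. by rewrite /ncov mulrC divfK ?gt_eqF// gcov_fin. Qed.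

Lemma ncov_ge0 t : 0 <= ncov f xi t.
Proof. by rewrite divr_ge0 ?(ltW nf_gt0)// -lee_fin gcov_fin gcov_ge0. Qed.

Lemma ncov_log_concave (l s t : R) : 0 < l < 1 ->
  ncov f xi s `^ l * ncov f xi t `^ (1 - l) <= ncov f xi (l * s + (1 - l) * t).
Proof.
move=> l01; have [l0 l1] := andP l01; have l1' : 0 < 1 - l by lra.
have := ncov_ge0 s; rewrite le_eqVlt => /predU1P[<-|s0].
  by rewrite powR0 ?gt_eqF// mul0r ncov_ge0.
have := ncov_ge0 t; rewrite le_eqVlt => /predU1P[<-|t0].
  by rewrite [0 `^ (1 - l)]powR0 ?gt_eqF// mulr0 ncov_ge0.
have := @gcov_log_concave _ f xi l s t _ _ Lf l01 (mulr_gt0 nf_gt0 s0) (mulr_gt0 nf_gt0 t0).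
rewrite !gcov_ncov !lexx => /(_ isT isT); rewrite lee_fin.
rewrite (powRM _ (ltW nf_gt0) (ltW s0)) (powRM _ (ltW nf_gt0) (ltW t0)) mulrACA -powRD; last first.
  by rewrite (gt_eqF nf_gt0) implybT.
by rewrite [l + _]addrC subrK powRr1 ?(ltW nf_gt0)// ler_pM2l.
Qed.

Lemma profile_ncov : profile (ncov f xi).
Proof.
have g0 : ncov f xi 0 = 1.
  by rewrite /ncov gcovE scale0r -L2sqE divff// gt_eqF.
split => // [t|s t s0 st|t l t0 l01]; first exact: ncov_ge0.
- move: st; rewrite le_eqVlt => /predU1P[->//|st].
  have t0 : 0 < t by lra.
  (* The weight for which s = l t + (1-l) (-t); by evenness both endpoints carry the value g(t). *)
  pose l := (s + t) / (2 * t).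
  have l01 : 0 < l < 1.
    by rewrite divr_gt0 ?ltr_pdivrMr//=; lra.
  have := @ncov_log_concave l t (- t) l01.
  have -> : l * t + (1 - l) * - t = s by rewrite /l; field; rewrite gt_eqF.
  have -> : ncov f xi (- t) = ncov f xi t by rewrite /ncov gcov_even.
  have := ncov_ge0 t; rewrite le_eqVlt => /predU1P[<- _|gt0]; first exact: ncov_ge0.
  rewrite -powRD; last by rewrite (gt_eqF gt0) implybT.
  by rewrite [l + _]addrC subrK powRr1// ltW.
- have := @ncov_log_concave l t 0 l01.
  by rewrite mulr0 addr0 g0 powR1 mulr1.
Qed.

(** The expanded square is integrated as (u - v)^2 + 2 u v = u^2 + v^2, with non-negative terms on
    both sides; the two squares have equal integrals by translation. *)
Lemma gdiff_ncov t : gdiff f xi t = (2 * fine (L2sq f) * (1 - ncov f xi t))%:E.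
Proof.
have shiftE : cov f (t *: xi) (t *: xi) = L2sq f.
  by rewrite L2sqE -(@cov_shift _ _ 0 0 (t *: xi))// add0r.
have Li : (L2sq f < +oo)%E by case/andP: f_L2.
have := @iint_additive _ _ (fun x => (f (x + t *: xi) * f (x + t *: xi))%:E)
  (fun x => (f (x + 0) * f (x + 0))%:E) (fun x => (f (x + 0) * f (x + t *: xi))%:E)
  (fun x => ((f (x + t *: xi) - f x) ^+ 2)%:E)
  (elc_mul _ _ Lf) (elc_mul _ _ Lf) (elc_mul _ _ Lf).
have -> : iint (fun x => (f (x + t *: xi) * f (x + t *: xi))%:E) = L2sq f by [].
have -> : iint (fun x => (f (x + 0) * f (x + 0))%:E) = L2sq f by rewrite L2sqE.
have -> : iint (fun x => (f (x + 0) * f (x + t *: xi))%:E) = gcov f xi t by rewrite gcovE.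
move=> /(_ _ _ Li Li) h.
have {}h : (gdiff f xi t + 2%:E * gcov f xi t = L2sq f + L2sq f)%E.
  apply: h => [x|x]; first by rewrite lee_fin sqr_ge0.
  by rewrite -!EFinM -!EFinD addr0; congr EFin; ring.
move: h; rewrite gcov_ncov -L2fin -EFinM -EFinD.
have : (0 <= gdiff f xi t)%E by apply: iint_ge0 => x; rewrite lee_fin sqr_ge0.
case: (gdiff f xi t) => [r _| |]//; rewrite -EFinD => -[h].
congr EFin; lra.
Qed.

End Normalized.
End Covariogram.

(** * Integrals of exponentials and powers *)

Section ExponentialIntegrals.
Variable R : realType.
Local Notation mu := (@lebesgue_measure R).

Lemma ftc_closed (f F : R -> R) (a b : R) : a < b ->
  (forall x, a <= x -> x <= b -> is_derive x 1 F (f x)) ->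
  (forall x, a <= x -> x <= b -> {for x, continuous f}) ->
  (\int[mu]_(x in `[a, b]) (f x)%:E = (F b - F a)%:E)%E.
Proof.
move=> ab dF cf.
have cF x : a <= x -> x <= b -> {for x, continuous F}.
  move=> ax xb; apply/differentiable_continuous/derivable1_diffP.
  by have [] := dF x ax xb.
rewrite (@continuous_FTC2 _ f F)//.
- apply: continuous_in_subspaceT => x; rewrite inE/= in_itv/= => /andP[ax xb].
  exact: cf.
- split.
  + by move=> x; rewrite in_itv/= => /andP[ax xb]; have [] := dF x (ltW ax) (ltW xb).
  + by apply: cvg_at_right_filter; exact: cF (lexx _) (ltW ab).
  + by apply: cvg_at_left_filter; exact: cF (ltW ab) (lexx _).
- move=> x; rewrite in_itv/= => /andP[ax xb]; rewrite derive1E.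
  by have [_ ->] := dF x (ltW ax) (ltW xb).
Qed.

Lemma ftc_infinite (f F : R -> R) (a l : R) :
  (forall x, a <= x -> 0 <= f x) ->
  (forall x, a <= x -> is_derive x 1 F (f x)) ->
  (forall x, a <= x -> {for x, continuous f}) ->
  F x @[x --> +oo] --> l ->
  (\int[mu]_(x in `[a, +oo[) (f x)%:E = (l - F a)%:E)%E.
Proof.
move=> f0 dF cf Fl.
have cF x : a <= x -> {for x, continuous F}.
  move=> ax; apply/differentiable_continuous/derivable1_diffP.
  by have [] := dF x ax.
rewrite (@ge0_continuous_FTC2y _ f F _ l)//.
- apply: continuous_in_subspaceT => x; rewrite inE/= in_itv/= andbT => ax.
  exact: cf.
- by move=> x ax; have [] := dF x (ltW ax).
- by apply: cvg_at_right_filter; exact: cF (lexx _).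
- move=> x; rewrite in_itv/= andbT => ax; rewrite derive1E.
  by have [_ ->] := dF x (ltW ax).
Qed.

Lemma integral_open_closed_infinite (f : R -> R) (a : R) : measurable_fun setT f ->
  (\int[mu]_(x in `]a, +oo[) (f x)%:E = \int[mu]_(x in `[a, +oo[) (f x)%:E)%E.
Proof.
move=> mf; apply: integral_itv_obnd_cbnd.
by apply/measurable_EFinP; exact: measurable_funTS.
Qed.

Lemma integral_open_closed (f : R -> R) (a b : R) : measurable_fun setT f ->
  (\int[mu]_(x in `]a, b[) (f x)%:E = \int[mu]_(x in `[a, b]) (f x)%:E)%E.
Proof.
move=> mf; apply/esym; apply: integral_itv_bndoo.
by apply/measurable_EFinP; exact: measurable_funTS.
Qed.

(** Tonelli on 0 < t < u, playing the part of an integration by parts. For a > 0 the power is p and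
    the exponential density q; for a < 0 they exchange places. *)
Lemma tonelli_triangle (p q : R -> R) : (forall x, 0 <= p x) -> (forall x, 0 <= q x) ->
  measurable_fun setT p -> measurable_fun setT q ->
  (\int[mu]_(t in `]0%R, +oo[) ((p t)%:E * \int[mu]_(u in `]t, +oo[) (q u)%:E) =
   \int[mu]_(u in `]0%R, +oo[) ((q u)%:E * \int[mu]_(t in `]0%R, u[) (p t)%:E))%E.
Proof.
move=> p0 q0 mp mq.
pose S := [set z : measurableTypeR R * measurableTypeR R | (0 < z.1) && (z.1 < z.2)].
pose K (z : measurableTypeR R * measurableTypeR R) := (p z.1 * q z.2 * \1_S z)%:E.
have mS : measurable S.
  have m1 : measurable_fun setT
      (fun z : measurableTypeR R * measurableTypeR R => (0 < z.1) && (z.1 < z.2)).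
    by apply: measurable_and; apply: measurable_fun_ltr.
  by have := m1 measurableT [set true]; rewrite setTI; exact.
have mK : measurable_fun setT K.
  apply/measurable_EFinP; apply: measurable_funM; last exact: measurable_indic.
  by apply: measurable_funM; exact: measurableT_comp.
have K0 z : (0 <= K z)%E by rewrite lee_fin !mulr_ge0.
rewrite [LHS]integral_mkcond [RHS]integral_mkcond.
transitivity (\int[mu]_t \int[mu]_u K (t, u))%E.
  apply: eq_integral => t _; rewrite patchE; case: ifPn => [|/negP t0].
    rewrite inE/= in_itv/= andbT => t0.
    rewrite -ge0_integralZl//; last 3 first.
    - by apply/measurable_EFinP; exact: measurable_funTS.
    - by move=> u _; rewrite lee_fin.
    - by rewrite lee_fin.
    rewrite integral_mkcond; apply: eq_integral => u _.
    rewrite patchE /K /= indicE; case: ifPn => [|/negP tu].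
      rewrite inE/= in_itv/= andbT => tu.
      by rewrite mem_set ?mulr1// /S/= t0 tu.
    rewrite memNset ?mulr0// /S/= => /andP[_ tu']; apply: tu.
    by rewrite inE/= in_itv/= tu'.
  rewrite integral0_eq// => u _; rewrite /K /= indicE memNset ?mulr0//.
  by move=> /andP[t0' _]; apply: t0; rewrite inE/= in_itv/= t0'.
rewrite (fubini_tonelli K)//.
apply: eq_integral => u _; rewrite patchE; case: ifPn => [|/negP u0].
  rewrite inE/= in_itv/= andbT => u0.
  rewrite -ge0_integralZl//; last 3 first.
  - by apply/measurable_EFinP; exact: measurable_funTS.
  - by move=> t _; rewrite lee_fin.
  - by rewrite lee_fin.
  rewrite [RHS]integral_mkcond; apply: eq_integral => t _.
  rewrite patchE /K /= indicE; case: ifPn => [|/negP tu].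
    rewrite inE/= in_itv/= => tu.
    by rewrite mem_set ?mulr1 1?mulrC// /S/= tu.
  rewrite memNset ?mulr0// /S/= => tu'; apply: tu.
  by rewrite inE/= in_itv.
rewrite integral0_eq// => t _; rewrite /K /= indicE memNset ?mulr0//.
move=> /andP[t0 tu]; apply: u0.
by rewrite inE/= in_itv/= andbT (lt_trans t0).
Qed.

Lemma cvg_powR_infinite (a : R) : a < 0 -> x `^ a @[x --> +oo] --> (0 : R).
Proof.
move=> a0; apply/cvgrPdist_lt => e e0; near=> x.
have x0 : 0 < x by near: x; apply: nbhs_pinfty_gt; exact: num_real.
rewrite sub0r normrN ger0_norm ?powR_ge0//.
have xe : e `^ a^-1 < x by near: x; apply: nbhs_pinfty_gt; exact: num_real.
have : (e `^ a^-1) `^ (- a) < x `^ (- a).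
  by apply: gt0_ltr_powR => //; rewrite ?oppr_gt0// nnegrE ?powR_ge0// ltW.
rewrite -powRrM mulrN mulVf ?lt_eqF// !powRN powRr1 ?(ltW e0)//.
by rewrite ltf_pV2// posrE powR_gt0.
Unshelve. all: by end_near. Qed.

Lemma cvg_expR_infinite (s : R) : 0 < s -> expR (- (x / s)) @[x --> +oo] --> (0 : R).
Proof.
move=> s0; apply/cvgrPdist_lt => e e0; near=> x.
rewrite sub0r normrN ger0_norm ?expR_ge0//.
have xe : - (s * ln e) < x by near: x; apply: nbhs_pinfty_gt; exact: num_real.
rewrite -[ltRHS]lnK ?posrE// ltr_expR ltrNl ltr_pdivlMr//.
by rewrite mulNr mulrC.
Unshelve. all: by end_near. Qed.

Lemma is_derive_expR_scale (s x : R) :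
  is_derive x 1 (fun x => - expR (- (x / s))) (s^-1 * expR (- (x / s))).
Proof.
have h : is_derive x 1 (fun x => - (x / s)) (- s^-1).
  rewrite (_ : (fun x => _) = (fun x => - s^-1 * x)); last first.
    by apply/funext => y; rewrite mulNr mulrC.
  by apply: is_derive_eq; rewrite /GRing.scale/=; ring.
by apply: is_derive_eq; rewrite /GRing.scale/=; ring.
Qed.

Lemma continuous_expR_scale (s : R) : continuous (fun x : R => s^-1 * expR (- (x / s))).
Proof.
move=> x; apply: cvgM; first exact: cvg_cst.
apply: continuous_comp; last exact: continuous_expR.
by apply: cvgN; apply: cvgM; [exact: cvg_id|exact: cvg_cst].
Qed.

Lemma measurable_expR_scale (s : R) :
  measurable_fun [set: R] (fun x : R => s^-1 * expR (- (x / s))).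
Proof. by apply: continuous_measurable_fun; exact: continuous_expR_scale. Qed.

Lemma integral_expR_tail (s t : R) : 0 < s ->
  (\int[mu]_(u in `]t, +oo[) (s^-1 * expR (- (u / s)))%:E = (expR (- (t / s)))%:E)%E.
Proof.
move=> s0; rewrite (integral_open_closed_infinite _ (measurable_expR_scale s)).
have f0 x : t <= x -> 0 <= s^-1 * expR (- (x / s)).
  by move=> _; rewrite mulr_ge0 ?invr_ge0 ?expR_ge0// ltW.
have cF : - expR (- (x / s)) @[x --> +oo] --> (0 : R).
  by rewrite -oppr0; apply: cvgN; exact: cvg_expR_infinite.
rewrite (ftc_infinite f0 (fun x _ => is_derive_expR_scale s x)
  (fun x _ => @continuous_expR_scale s x) cF).
by rewrite sub0r opprK.
Qed.

Lemma integral_expR_head (s t : R) : 0 < t ->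
  (\int[mu]_(u in `]0%R, t[) (s^-1 * expR (- (u / s)))%:E = (1 - expR (- (t / s)))%:E)%E.
Proof.
move=> t0; rewrite (integral_open_closed _ _ (measurable_expR_scale s)).
rewrite (ftc_closed t0 (fun x _ _ => is_derive_expR_scale s x)
  (fun x _ _ => @continuous_expR_scale s x)).
by rewrite mul0r oppr0 expR0 opprK addrC.
Qed.

Lemma continuous_powR (a x : R) : 0 < x -> {for x, continuous (fun y : R => y `^ a)}.
Proof.
move=> x0; apply/differentiable_continuous/derivable1_diffP.
by apply: derivable_powR; rewrite in_itv/= x0.
Qed.

Lemma measurable_powR_scale (c a : R) : measurable_fun [set: R] (fun x : R => c * x `^ a).
Proof. by apply: measurable_funM => //; exact: measurable_powR. Qed.

Lemma integral_powR_tail (a u : R) : a < 0 -> 0 < u ->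
  (\int[mu]_(t in `]u, +oo[) (`|a| * t `^ (a - 1))%:E = (u `^ a)%:E)%E.
Proof.
move=> a0 u0; rewrite (integral_open_closed_infinite _ (measurable_powR_scale _ _)).
have f0 x : u <= x -> 0 <= `|a| * x `^ (a - 1).
  by move=> _; rewrite mulr_ge0 ?powR_ge0.
have dF x : u <= x -> is_derive x 1 (fun x : R => - x `^ a) (`|a| * x `^ (a - 1)).
  move=> ux; have x0 : 0 < x by lra.
  by rewrite ltr0_norm// mulNr; apply: is_deriveN; exact: is_derive1_powR.
have cf x : u <= x -> {for x, continuous (fun x : R => `|a| * x `^ (a - 1))}.
  move=> ux; have x0 : 0 < x by lra.
  by apply: cvgM; [exact: cvg_cst|exact: continuous_powR].
have cF : - x `^ a @[x --> +oo] --> (0 : R).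
  by rewrite -oppr0; apply: cvgN; exact: cvg_powR_infinite.
by rewrite (ftc_infinite f0 dF cf cF) sub0r opprK.
Qed.

Lemma integral_powR_segment (a e u : R) : 0 < a -> 0 < e -> e < u ->
  (\int[mu]_(t in `[e, u]) (a * t `^ (a - 1))%:E = (u `^ a - e `^ a)%:E)%E.
Proof.
move=> a0 e0 eu.
have dF x : e <= x -> x <= u -> is_derive x 1 (fun x : R => x `^ a) (a * x `^ (a - 1)).
  by move=> ex xu; apply: is_derive1_powR; exact: lt_le_trans ex.
have cf x : e <= x -> x <= u -> {for x, continuous (fun x : R => a * x `^ (a - 1))}.
  move=> ex xu; have x0 : 0 < x by lra.
  by apply: cvgM; [exact: cvg_cst|exact: continuous_powR].
by rewrite (ftc_closed eu dF cf).
Qed.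

(* For a < 1 the integrand is unbounded at 0. The cut-offs are chosen so that
   their a-th powers are u^a / (i+2). *)
Lemma integral_powR_head (a u : R) : 0 < a -> 0 < u ->
  (\int[mu]_(t in `]0%R, u[) (a * t `^ (a - 1))%:E = (u `^ a)%:E)%E.
Proof.
move=> a0 u0; have ai0 : 0 < a^-1 by rewrite invr_gt0.
pose e (i : nat) : R := u * (i.+2%:R^-1) `^ a^-1.
have e_gt0 i : 0 < e i by rewrite mulr_gt0// powR_gt0// invr_gt0.
have e_powR i : e i `^ a = u `^ a * i.+2%:R^-1.
  rewrite powRM ?powR_ge0 ?(ltW u0)// -powRrM mulVf ?gt_eqF//.
  by rewrite powRr1// invr_ge0.
have e_lt i : e i < u.
  rewrite gtr_pMr// -[ltRHS](_ : 1 `^ a^-1 = 1); last by rewrite powR1.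
  rewrite gt0_ltr_powR ?nnegrE ?invr_ge0//.
  by rewrite invf_lt1// ltr1n.
have e_le i j : (i <= j)%N -> e j <= e i.
  move=> ij; rewrite ler_pM2l// ge0_ler_powR ?nnegrE ?invr_ge0 ?(ltW a0)//.
  by rewrite lef_pV2 ?posrE ?ltr0n// ler_nat.
pose F (i : nat) : set R := `[e i, u]%classic.
have FU : \bigcup_i F i = `]0%R, u]%classic.
  apply/seteqP; split => [x [i _]|x] /=.
    rewrite /F/= in_itv/= => /andP[ex xu]; rewrite in_itv/= xu andbT.
    exact: lt_le_trans (e_gt0 i) ex.
  rewrite in_itv/= => /andP[x0 xu]; pose r := (x / u) `^ a.
  have r0 : 0 < r by rewrite powR_gt0// divr_gt0.
  (* An index i with 1/(i+2) <= (x/u)^a, which says that the cut-off [e i] is at most x. *)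
  exists (Num.truncn r^-1) => //; rewrite /F/= in_itv/= xu andbT.
  have h : (Num.truncn r^-1).+2%:R^-1 <= r.
    rewrite invf_ple ?posrE ?ltr0n//; apply: ltW.
    by apply: lt_trans (truncnS_gt _) _; rewrite ltr_nat.
  have : (Num.truncn r^-1).+2%:R^-1 `^ a^-1 <= r `^ a^-1.
    by rewrite ge0_ler_powR ?nnegrE ?invr_ge0 ?(ltW a0) ?(ltW r0).
  rewrite /r -powRrM divff ?gt_eqF// powRr1 ?divr_ge0 ?(ltW x0) ?(ltW u0)//.
  by rewrite ler_pdivlMr// mulrC.
have mf := measurable_powR_scale a (a - 1).
rewrite (integral_open_closed _ _ mf).
rewrite -integral_itv_obnd_cbnd; last by apply/measurable_EFinP; exact: measurable_funTS.
rewrite -FU.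
have cv := @ge0_nondecreasing_set_cvg_integral _ (measurableTypeR R) R F
  (fun t => (a * t `^ (a - 1))%:E) mu.
have {}cv : (\int[mu]_(x in F i) (a * x `^ (a - 1))%:E @[i --> \oo] -->
    \int[mu]_(x in \bigcup_i F i) (a * x `^ (a - 1))%:E)%E.
  apply: cv => [i j ij|i|i|i x _].
  - apply/subsetPset => x; rewrite /F/= in_itv/= => /andP[ex xu].
    by rewrite in_itv/= xu andbT (le_trans _ ex)// e_le.
  - exact: measurable_itv.
  - by apply/measurable_EFinP; exact: measurable_funTS.
  - by rewrite lee_fin mulr_ge0 ?powR_ge0 ?(ltW a0).
have E : (fun i => \int[mu]_(x in F i) (a * x `^ (a - 1))%:E)%E =
    (fun i : nat => (u `^ a - u `^ a * i.+2%:R^-1)%:E).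
  by apply/funext => i; rewrite /F (integral_powR_segment a0 (e_gt0 i) (e_lt i)) e_powR.
have h : (u `^ a - u `^ a * i.+2%:R^-1) @[i --> \oo] --> (u `^ a - u `^ a * 0 : R).
  apply: cvgB; first exact: cvg_cst.
  apply: cvgM; first exact: cvg_cst.
  by have := @cvg_harmonic R; rewrite -(cvg_shiftS (@harmonic R)).
rewrite E in cv; apply: (cvg_unique _ cv) => //.
rewrite mulr0 subr0 in h.
by apply: cvg_EFin; [near=> i|exact: h].
Unshelve. all: by end_near. Qed.

End ExponentialIntegrals.

(** * Gamma integrals and Frullani's integral *)

Section GammaIntegrals.
Variable R : realType.
Local Notation mu := (@lebesgue_measure R).
Local Notation Rpos := (`]0%R, +oo[%classic : set R).

(** The moment of order a of the exponential law of mean s, equal to s^a Gamma(a+1) for a > -1. *)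
Definition gamma_int (a s : R) : \bar R :=
  (\int[mu]_(u in Rpos) (u `^ a * (s^-1 * expR (- (u / s))))%:E)%E.

Lemma measurable_expR_div (s : R) : measurable_fun [set: R] (fun t : R => expR (- (t / s))).
Proof.
apply: measurableT_comp => //; apply: measurableT_comp => //.
exact: measurable_funM.
Qed.

(** e^(-t/s) is the integral of the exponential density over ]t,
    +oo[, and a t^(a-1) integrates to u^a over ]0, u[. *)
Lemma gamma_int_pos (a s : R) : 0 < a -> 0 < s ->
  (\int[mu]_(t in Rpos) (a * t `^ (a - 1) * expR (- (t / s)))%:E = gamma_int a s)%E.
Proof.
move=> a0 s0.
have := @tonelli_triangle R (fun t => a * t `^ (a - 1)) (fun u => s^-1 * expR (- (u / s))).
move=> /(_ _ _ (measurable_powR_scale _ _) (measurable_expR_scale _)) H.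
transitivity (\int[mu]_(t in Rpos) ((a * t `^ (a - 1))%:E *
    \int[mu]_(u in `]t, +oo[) (s^-1 * expR (- (u / s)))%:E))%E.
  by apply: eq_integral => t _; rewrite integral_expR_tail.
rewrite H => [|x|x].
- apply: eq_integral => u; rewrite inE/= in_itv/= andbT => u0.
  by rewrite integral_powR_head// -EFinM mulrC.
- by rewrite mulr_ge0 ?powR_ge0 ?ltW.
- by rewrite mulr_ge0 ?expR_ge0 ?invr_ge0 ?ltW.
Qed.

(** 1 - e^(-t/s) is the integral of the density over ]0, t[, and |a| t^(a-1) now integrates to u^a
    over the tail ]u, +oo[. *)
Lemma gamma_int_neg (a s : R) : a < 0 -> 0 < s ->
  (\int[mu]_(t in Rpos) (`|a| * t `^ (a - 1) * (1 - expR (- (t / s))))%:E = gamma_int a s)%E.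
Proof.
move=> a0 s0.
have := @tonelli_triangle R (fun u => s^-1 * expR (- (u / s))) (fun t => `|a| * t `^ (a - 1)).
move=> /(_ _ _ (measurable_expR_scale _) (measurable_powR_scale _ _)) H.
transitivity (\int[mu]_(u in Rpos) ((`|a| * u `^ (a - 1))%:E *
    \int[mu]_(t in `]0%R, u[) (s^-1 * expR (- (t / s)))%:E))%E.
  apply: eq_integral => t; rewrite inE/= in_itv/= andbT => t0.
  by rewrite integral_expR_head.
rewrite -H => [|x|x].
- apply: eq_integral => u; rewrite inE/= in_itv/= andbT => u0.
  by rewrite integral_powR_tail// -EFinM mulrC.
- by rewrite mulr_ge0 ?expR_ge0 ?invr_ge0 ?ltW.
- by rewrite mulr_ge0 ?powR_ge0.
Qed.

Lemma gamma_int_scale (a s : R) : 0 < s -> gamma_int a s = ((s `^ a)%:E * gamma_int a 1)%E.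
Proof.
move=> s0; have si0 : 0 < s^-1 by rewrite invr_gt0.
pose f u := ((u `^ a * (1^-1 * expR (- (u / 1))))%:E : \bar R).
have mf : measurable_fun [set: R] f.
  apply/measurable_EFinP; apply: measurable_funM; first exact: measurable_powR.
  exact: measurable_expR_scale.
have f0 x : (0 <= f x)%E.
  by rewrite lee_fin mulr_ge0 ?powR_ge0// mulr_ge0 ?expR_ge0// invr1.
rewrite [gamma_int a 1]/gamma_int -[X in (_ * X)%E](ge0_integral_scale si0 mf f0).
rewrite muleA -EFinM -ge0_integralZl//.
- apply: eq_integral => u; rewrite inE/= in_itv/= andbT => u0.
  rewrite /f -EFinM; congr EFin; rewrite powRM ?invr_ge0 ?(ltW u0) ?(ltW s0)//.
  have -> : s^-1 `^ a = (s `^ a)^-1.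
    by rewrite -powRN -[s^-1]powR_inv1 ?(ltW s0)// -powRrM mulN1r.
  have sa : s `^ a != 0 by rewrite gt_eqF// powR_gt0.
  by rewrite invr1 mul1r mulr1 (mulrC s^-1 u); field; rewrite sa (gt_eqF s0).
- apply: measurable_funTS; apply: (measurableT_comp mf).
  exact: measurable_funM.
- by rewrite lee_fin mulr_ge0 ?powR_ge0 ?invr_ge0 ?(ltW s0).
Qed.

Lemma gamma_int_Gamma (a : R) : (Gamma (a + 1) = fine (gamma_int a 1)).
Proof.
rewrite /Gamma /gamma_int; congr fine; apply: eq_integral => t _.
by rewrite addrK invr1 mul1r mulr1.
Qed.

Lemma gamma_int_ge0 (a s : R) : 0 < s -> (0 <= gamma_int a s)%E.
Proof.
move=> s0; apply: integral_ge0 => u _.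
by rewrite lee_fin mulr_ge0 ?powR_ge0// mulr_ge0 ?expR_ge0// invr_ge0 ltW.
Qed.

Lemma measurable_gamma_fun (a s : R) :
  measurable_fun [set: R] (fun u : R => u `^ a * (s^-1 * expR (- (u / s)))).
Proof.
by apply: measurable_funM; [exact: measurable_powR|exact: measurable_expR_scale].
Qed.

Lemma gamma_int_finite_pos (a : R) : 0 < a -> (gamma_int a 1 < +oo)%E.
Proof.
move=> a0; have a20 : 0 < 2 * a by rewrite mulr_gt0.
(* From u/(2a) <= e^(u/(2a)) follows u^a <= (2a)^a e^(u/2); the factor 2 normalizes the density of
   mean 2. *)
pose C := (2 * a) `^ a * 2.
have C0 : 0 <= C by rewrite mulr_ge0 ?powR_ge0.
apply: (@le_lt_trans _ _ (\int[mu]_(u in Rpos) (C%:E * (2^-1 * expR (- (u / 2)))%:E))%E).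
  apply: ge0_le_integral => //.
  - by move=> u _; rewrite lee_fin mulr_ge0 ?powR_ge0// mulr_ge0 ?expR_ge0// invr1.
  - by apply/measurable_EFinP; apply: measurable_funTS; exact: measurable_gamma_fun.
  - apply: measurable_funeM; apply/measurable_EFinP; apply: measurable_funTS.
    exact: measurable_expR_scale.
  - move=> u; rewrite /= in_itv/= andbT => u0.
    rewrite -EFinM lee_fin invr1 mul1r mulr1 /C mulrA -(mulrA _ 2) divff// mulr1.
    have -> : expR (- u) = (expR (u / 2))^-1 * expR (- (u / 2)).
      by rewrite -expRN -expRD; congr expR; lra.
    rewrite mulrA ler_pM2r ?expR_gt0// ler_pdivrMr ?expR_gt0//.
    have -> : expR (u / 2) = expR (u / (2 * a)) `^ a.
      by rewrite -expRM; congr expR; field; rewrite gt_eqF.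
    rewrite -powRM ?expR_ge0 ?(ltW a20)//.
    apply: ge0_ler_powR; rewrite ?nnegrE ?(ltW a0) ?(ltW u0)//.
      by rewrite mulr_ge0 ?expR_ge0 ?(ltW a20).
    rewrite mulrC -ler_pdivrMr//; apply: le_trans (expR_ge1Dx _).
    by rewrite lerDr.
rewrite ge0_integralZl//.
- by rewrite integral_expR_tail// mul0r oppr0 expR0 mule1 ltry.
- by apply/measurable_EFinP; apply: measurable_funTS; exact: measurable_expR_scale.
Qed.

(** For a <= 0, the functional equation Gamma(a+2) = (a+1) Gamma(a+1) leads back to the positive
    order a + 1. *)
Lemma gamma_int_finite (a : R) : -1 < a -> (gamma_int a 1 < +oo)%E.
Proof.
move=> a1; have a10 : 0 < a + 1 by lra.
have [a0|_] := ltP 0 a; first exact: gamma_int_finite_pos.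
have := gamma_int_finite_pos a10; rewrite -(gamma_int_pos a10 ltr01).
rewrite (_ : integral mu _ _ = ((a + 1)%:E * gamma_int a 1)%E).
  move=> h; rewrite ltey; apply/eqP => ay; move: h.
  by rewrite ay gt0_muley ?lte_fin.
rewrite /gamma_int -ge0_integralZl//.
- by apply: eq_integral => t _; rewrite -EFinM addrK invr1 mul1r mulrA.
- by apply/measurable_EFinP; apply: measurable_funTS; exact: measurable_gamma_fun.
- by move=> u _; rewrite lee_fin mulr_ge0 ?powR_ge0// mulr_ge0 ?expR_ge0// invr1.
- by rewrite lee_fin ltW.
Qed.

Lemma gamma_int_gt0 (a : R) : -1 < a -> (0 < gamma_int a 1)%E.
Proof.
(* On [1, 2], u^a >= 1/u >= 1/2 because a > -1, and e^(-u) >= e^(-2). *)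
move=> a1; apply: (@lt_le_trans _ _ (2^-1 * expR (-2) * (2 - 1))%:E).
  by rewrite lte_fin !mulr_gt0 ?expR_gt0//; lra.
have -> : (2^-1 * expR (-2) * (2 - 1))%:E =
    (\int[mu]_(u in (`[1%R, 2%R]%classic : set R)) cst (2^-1 * expR (-2))%:E u)%E.
  by rewrite integral_cst//= lebesgue_measure_itv/= lte_fin ltr1n -EFinB -EFinM.
rewrite /gamma_int [leLHS]integral_mkcond [leRHS]integral_mkcond.
apply: le_integral_setT => u.
  by apply: erestrict_ge0 => ? _; rewrite lee_fin mulr_ge0 ?expR_ge0.
rewrite !patchE; case: ifPn => [|_]; last first.
  by case: ifPn => // _; rewrite lee_fin mulr_ge0 ?powR_ge0// mulr_ge0 ?expR_ge0// invr1.
rewrite inE/= in_itv/= => /andP[u1 u2]; have u0 : 0 < u by lra.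
rewrite mem_set/=; last by rewrite in_itv/= u0.
rewrite lee_fin invr1 mul1r mulr1; apply: ler_pM; rewrite ?expR_ge0//.
  apply: (@le_trans _ _ (u `^ (-1))); last by rewrite ler_powR// ltW.
  by rewrite powR_inv1 ?(ltW u0)// lef_pV2 ?posrE.
by rewrite ler_expR lerN2.
Qed.

Lemma Gamma_gt0 (a : R) : -1 < a -> 0 < Gamma (a + 1).
Proof.
move=> a1; rewrite gamma_int_Gamma fine_gt0// gamma_int_gt0//=.
exact: gamma_int_finite.
Qed.

Lemma gamma_intE (a s : R) : -1 < a -> 0 < s ->
  gamma_int a s = (s `^ a * Gamma (a + 1))%:E.
Proof.
move=> a1 s0; rewrite gamma_int_scale// gamma_int_Gamma EFinM fineK//.
by rewrite ge0_fin_numE ?gamma_int_ge0// gamma_int_finite.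
Qed.

Lemma integral_expR_segment (s a b : R) : a < b ->
  (\int[mu]_(u in `]a, b[) (s^-1 * expR (- (u / s)))%:E =
   (expR (- (a / s)) - expR (- (b / s)))%:E)%E.
Proof.
move=> ab; rewrite (integral_open_closed _ _ (measurable_expR_scale s)).
rewrite (ftc_closed ab (fun x _ _ => is_derive_expR_scale s x)
  (fun x _ _ => @continuous_expR_scale _ s x)).
by congr EFin; ring.
Qed.

Lemma integral_inv_segment (a b : R) : 0 < a -> a < b ->
  (\int[mu]_(u in (`]a, b[%classic : set R)) (u^-1)%:E = (ln b - ln a)%:E)%E.
Proof.
move=> a0 ab.
have mi : measurable_fun [set: R] (fun u : R => u `^ (-1)) by exact: measurable_powR.
transitivity (\int[mu]_(u in (`]a, b[%classic : set R)) (u `^ (-1))%:E)%E.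
  apply: eq_integral => u; rewrite inE/= in_itv/= => /andP[au _].
  by rewrite powR_inv1// ltW// (lt_trans a0).
rewrite (integral_open_closed _ _ mi).
have dF x : a <= x -> x <= b -> is_derive x 1 (@ln R) (x `^ (-1)).
  move=> ax _; have x0 : 0 < x by exact: lt_le_trans ax.
  by rewrite powR_inv1 ?(ltW x0)//; exact: is_derive1_ln.
rewrite (ftc_closed ab dF)// => x ax _.
by apply: continuous_powR; exact: lt_le_trans ax.
Qed.

(** The integrand is the integral of e^(-t r) over r in ]a, b[; after Tonelli the inner integral is
    1/r. *)
Lemma frullani (a b : R) : 0 < a -> a < b ->
  (\int[mu]_(t in Rpos) ((expR (- (t * a)) - expR (- (t * b))) / t)%:E = (ln b - ln a)%:E)%E.
Proof.
move=> a0 ab.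
pose E := (`]a, b[%classic : set R).
have mE : measurable (E : set (measurableTypeR R)) by exact: measurable_itv.
pose K (z : measurableTypeR R * measurableTypeR R) :=
  (\1_Rpos z.1 * \1_E z.2 * expR (- (z.1 * z.2)))%:E.
have mK : measurable_fun setT K.
  apply/measurable_EFinP; apply: measurable_funM.
    apply: measurable_funM.
      exact: (measurableT_comp (measurable_indic (measurable_itv _)) measurable_fst).
    exact: (measurableT_comp (measurable_indic (measurable_itv _)) measurable_snd).
  apply: measurableT_comp => //; apply: measurableT_comp => //.
  by apply: measurable_funM.
have K0 z : (0 <= K z)%E by rewrite lee_fin !mulr_ge0 ?expR_ge0.
have e0 (x y : R) : (0 <= (expR (- (x * y)))%:E)%E by rewrite lee_fin expR_ge0.
have me (x : R) (A : set R) : measurable A ->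
    measurable_fun A (fun y : R => (expR (- (x * y)))%:E).
  move=> mA; apply/measurable_EFinP; apply: measurable_funTS.
  by apply: measurableT_comp => //; apply: measurableT_comp => //; exact: measurable_funM.
transitivity (\int[mu]_t \int[mu]_r K (t, r))%E.
  rewrite integral_mkcond; apply: eq_integral => t _; rewrite patchE.
  case: ifPn => [tp|tp]; last first.
    by rewrite integral0_eq// => r _; rewrite /K /= indicE (negbTE tp) !mul0r.
  have t0 : 0 < t by move: tp; rewrite inE/= in_itv/= andbT.
  transitivity (\int[mu]_(r in E) (expR (- (t * r)))%:E)%E; last first.
    rewrite integral_mkcond; apply: eq_integral => r _; rewrite patchE /K /= !indicE tp mul1r.
    by case: ifPn => _; rewrite ?mul1r ?mul0r.
  transitivity (t^-1%:E * \int[mu]_(r in E) (t^-1^-1 * expR (- (r / t^-1)))%:E)%E.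
    by rewrite integral_expR_segment// -EFinM invrK mulrC ![t * _]mulrC.
  rewrite -ge0_integralZl//; last 3 first.
  - by apply/measurable_EFinP; apply: measurable_funTS; exact: measurable_expR_scale.
  - by move=> r _; rewrite lee_fin mulr_ge0 ?expR_ge0// invrK ltW.
  - by rewrite lee_fin invr_ge0 ltW.
  apply: eq_integral => r _; rewrite -EFinM invrK mulrA mulVf ?gt_eqF// mul1r.
  by rewrite mulrC.
rewrite (fubini_tonelli K)//.
rewrite -integral_inv_segment// [RHS]integral_mkcond.
apply: eq_integral => r _; rewrite patchE.
case: ifPn => [rp|rp]; last first.
  by rewrite integral0_eq// => t _; rewrite /K /= !indicE (negbTE rp) mulr0 mul0r.
have r0 : 0 < r by move: rp; rewrite inE/= in_itv/= => /andP[/(lt_trans a0)].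
transitivity (\int[mu]_(t in Rpos) (expR (- (r * t)))%:E)%E.
  rewrite [RHS]integral_mkcond; apply: eq_integral => t _; rewrite patchE /K /= !indicE rp mulr1.
  by case: ifPn => _; rewrite ?mul1r ?mul0r// mulrC.
transitivity (r^-1%:E * \int[mu]_(t in Rpos) (r^-1^-1 * expR (- (t / r^-1)))%:E)%E; last first.
  by rewrite integral_expR_tail ?invr_gt0// mul0r oppr0 expR0 mule1.
rewrite -ge0_integralZl//; last 3 first.
- by apply/measurable_EFinP; apply: measurable_funTS; exact: measurable_expR_scale.
- by move=> t _; rewrite lee_fin mulr_ge0 ?expR_ge0// invrK ltW.
- by rewrite lee_fin invr_ge0 ltW.
apply: eq_integral => t _; rewrite -EFinM invrK mulrA mulVf ?gt_eqF// mul1r.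
by rewrite mulrC.
Qed.

(** The counterpart of [gamma_int] at order 0. The sign of the integrand is constant and depends on
    how s compares with 1, so Frullani's integral gives integrability together with the value. *)
Lemma integrable_exp_difference (s : R) : 0 < s ->
  mu.-integrable Rpos (fun t => ((expR (- (t / s)) - expR (- t)) / t)%:E) /\
  (\int[mu]_(t in Rpos) ((expR (- (t / s)) - expR (- t)) / t)%:E = (ln s)%:E)%E.
Proof.
move=> s0.
have minv : measurable_fun Rpos (fun t : R => t^-1).
  apply: (@eq_measurable_fun _ _ _ _ _ (fun t : R => t `^ (-1))).
    by move=> t; rewrite inE/= in_itv/= andbT => t0; rewrite powR_inv1// ltW.
  by apply: measurable_funTS; exact: measurable_powR.
have mdiff (a b : R) :
    measurable_fun Rpos (fun t : R => (expR (- (t * a)) - expR (- (t * b))) / t).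
  apply: measurable_funM => //; apply: measurable_funTS.
  have me c : measurable_fun [set: R] (fun t : R => expR (- (t * c))).
    by apply: measurableT_comp => //; apply: measurableT_comp => //; exact: measurable_funM.
  exact: measurable_funB.
have ifr (a b : R) : 0 < a -> a < b ->
    mu.-integrable Rpos (fun t => ((expR (- (t * a)) - expR (- (t * b))) / t)%:E).
  move=> a0 ab; apply/integrableP; split.
    by apply/measurable_EFinP; exact: mdiff.
  rewrite (_ : integral mu _ _ = (ln b - ln a)%:E) ?ltry//.
  rewrite -frullani//; apply: eq_integral => t; rewrite inE/= in_itv/= andbT => t0.
  rewrite ger0_norm// divr_ge0 ?(ltW t0)// subr_ge0 ler_expR lerN2.
  by rewrite ler_pM2l// ltW.
have [s1|] := ltP s 1.
  have E : (fun t : R => ((expR (- (t / s)) - expR (- t)) / t)%:E) = (fun t : R =>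
      ((-1)%:E * ((expR (- (t * 1)) - expR (- (t * s^-1))) / t)%:E)%E).
    by apply/funext => t; rewrite mulr1 -EFinM; congr EFin; ring.
  have si1 : 1 < s^-1 by rewrite invf_gt1.
  have I := ifr _ _ ltr01 si1; rewrite E; split.
    exact: (@integrableZl _ (measurableTypeR R) R mu Rpos (measurable_itv _) (-1) _ I).
  rewrite (@integralZl _ (measurableTypeR R) R mu Rpos (measurable_itv _) _ I).
  by rewrite frullani// ln1 subr0 lnV ?posrE// -EFinM mulN1r opprK.
rewrite le_eqVlt => /predU1P[<-|s1].
  have E : (fun t : R => ((expR (- (t / 1)) - expR (- t)) / t)%:E) = cst 0%E.
    by apply/funext => t; rewrite invr1 mulr1 subrr mul0r.
  by rewrite E integral0 ln1; split => //; exact: integrable0.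
have E : (fun t : R => ((expR (- (t / s)) - expR (- t)) / t)%:E) = (fun t : R =>
    ((expR (- (t * s^-1)) - expR (- (t * 1))) / t)%:E).
  by apply/funext => t; rewrite mulr1.
have si1 : s^-1 < 1 by rewrite invf_lt1.
have si0 : 0 < s^-1 by rewrite invr_gt0.
rewrite E; split; first exact: ifr.
by rewrite frullani// ln1 sub0r lnV ?posrE// opprK.
Qed.

End GammaIntegrals.

(** * Radii of log-concave profiles *)

Section Profiles.
Variable R : realType.
Local Notation mu := (@lebesgue_measure R).
Local Notation Rpos := (`]0%R, +oo[%classic : set R).

Definition profile_radius (a : R) (g : R -> R) : \bar R :=
  if 0 < a then
    epow (a%:E * \int[mu]_(t in Rpos) (t `^ (a - 1) * g t)%:E)%E a^-1
  else if a < 0 then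
    epow (`|a|%:E * \int[mu]_(t in Rpos) (t `^ (a - 1) * (1 - g t))%:E)%E a^-1
  else
    match (\int[mu]_(t in Rpos) ((g t - expR (- t)) / t)%:E)%E with
    | r%:E => (expR (- euler_gamma R + r))%:E
    | +oo%E => +oo%E
    | -oo%E => 0%E
    end.

Definition normalized_radius (a : R) (g : R -> R) : \bar R :=
  ((Gfac a)^-1%:E * profile_radius a g)%E.

(* The inequality s <= normalized_radius a g, freed from powers: this is
   normalized_radius_ge below. *)
Definition above (a s : R) (g : R -> R) : Prop :=
  if 0 < a then
    (gamma_int a s <= a%:E * \int[mu]_(t in Rpos) (t `^ (a - 1) * g t)%:E)%E
  else if a < 0 then
    (`|a|%:E * \int[mu]_(t in Rpos) (t `^ (a - 1) * (1 - g t))%:E <= gamma_int a s)%E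
  else ((ln s)%:E <= \int[mu]_(t in Rpos) ((g t - expR (- t)) / t)%:E)%E.

Lemma powR_nonincreasing (p x y : R) : p < 0 -> 0 < x -> x <= y -> y `^ p <= x `^ p.
Proof.
move=> p0 x0 xy; have y0 : 0 < y by exact: lt_le_trans xy.
rewrite -[p]opprK (powRN y) (powRN x) lef_pV2 ?posrE ?powR_gt0//.
by rewrite ge0_ler_powR ?nnegrE ?oppr_ge0 ?(ltW p0) ?(ltW x0) ?(ltW y0).
Qed.

Lemma powR_inv_exp (x p : R) : 0 <= x -> p != 0 -> (x `^ p) `^ p^-1 = x.
Proof. by move=> x0 p0; rewrite -powRrM divff// powRr1. Qed.

Lemma epow_ge_pos (a C s : R) (x : \bar R) : 0 < a -> 0 < C -> 0 < s -> (0 <= x)%E ->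
  (s%:E <= ((C `^ a^-1)^-1)%:E * epow x a^-1)%E = ((s `^ a * C)%:E <= x)%E.
Proof.
move=> a0 C0 s0; have ai0 : 0 < a^-1 by rewrite invr_gt0.
have Ca0 : 0 < C `^ a^-1 by rewrite powR_gt0.
have sa0 : 0 < s `^ a by rewrite powR_gt0.
case: x => [r| |]// r0; last first.
  by rewrite /= ai0 gt0_muley ?lte_fin ?invr_gt0// !leey.
rewrite lee_fin in r0.
have -> : epow r%:E a^-1 = (r `^ a^-1)%:E.
  rewrite /=; case: ifPn => // /eqP ->; rewrite ai0 powR0// gt_eqF//.
rewrite -EFinM !lee_fin mulrC ler_pdivlMr//.
rewrite -{1}(powR_inv_exp (ltW s0) (lt0r_neq0 a0)) -powRM ?(ltW sa0) ?(ltW C0)//.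
apply/idP/idP => h; last first.
  by rewrite ge0_ler_powR ?nnegrE ?(ltW ai0)// mulr_ge0 ?(ltW sa0) ?(ltW C0).
rewrite leNgt; apply/negP => h'.
have := @gt0_ltr_powR _ _ ai0 r (s `^ a * C).
rewrite !nnegrE r0 mulr_ge0 ?(ltW sa0) ?(ltW C0)// => /(_ isT isT h').
by rewrite ltNge h.
Qed.

(** A negative exponent exchanges 0 and +oo and reverses the order: a lower bound on the radius is
    an upper bound on the integral. *)
Lemma epow_ge_neg (a C s : R) (x : \bar R) : a < 0 -> 0 < C -> 0 < s -> (0 <= x)%E ->
  (s%:E <= ((C `^ a^-1)^-1)%:E * epow x a^-1)%E = (x <= (s `^ a * C)%:E)%E.
Proof.
move=> a0 C0 s0; have ai0 : a^-1 < 0 by rewrite invr_lt0.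
have Ca0 : 0 < C `^ a^-1 by rewrite powR_gt0.
have sa0 : 0 < s `^ a by rewrite powR_gt0.
case: x => [r| |]// r0; last first.
  rewrite /= ltNge (ltW ai0)/= mule0 lee_fin leNgt s0/=.
  by apply/esym/negbTE; rewrite -ltNge ltry.
rewrite lee_fin in r0; rewrite /=; case: ifPn => [/eqP ->|rn0].
  rewrite ltNge (ltW ai0)/= gt0_muley ?lte_fin ?invr_gt0// leey lee_fin.
  by rewrite mulr_ge0 ?(ltW sa0) ?(ltW C0).
have {rn0}r0 : 0 < r by rewrite lt_neqAle eq_sym rn0.
rewrite -EFinM !lee_fin mulrC ler_pdivlMr//.
rewrite -{1}(powR_inv_exp (ltW s0) (ltr0_neq0 a0)) -powRM ?(ltW sa0) ?(ltW C0)//.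
apply/idP/idP => h; last exact: powR_nonincreasing.
rewrite leNgt; apply/negP => h'.
have : (s `^ a * C) `^ (- a^-1) < r `^ (- a^-1).
  by rewrite gt0_ltr_powR ?oppr_gt0 ?nnegrE// ?mulr_ge0 ?(ltW sa0) ?(ltW C0) ?(ltW r0).
rewrite !powRN ltf_pV2 ?posrE ?powR_gt0 ?mulr_gt0//.
by rewrite ltNge h.
Qed.

Lemma Rpos_gt0 (t : R) : Rpos t -> 0 < t.
Proof. by rewrite /= in_itv/= andbT. Qed.

(** Raising to the power a turns s into s^a Gamma(a+1), the value of [gamma_int a s]. At a = 0 the
    e^(-gamma) in [Gfac] cancels the one in the radius. *)
Lemma normalized_radius_ge (g : R -> R) (a s : R) :
  (forall t, 0 < t -> 0 <= g t <= 1) -> -1 < a -> 0 < s ->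
  ((s%:E <= normalized_radius a g)%E <-> above a s g).
Proof.
move=> g01 a1 s0; have G0 := Gamma_gt0 a1.
rewrite /normalized_radius /profile_radius /above /Gfac gamma_intE//.
have [a0|a0] := ltP 0 a.
  rewrite gt_eqF// epow_ge_pos// mule_ge0 ?lee_fin ?(ltW a0)//.
  apply: integral_ge0 => t /Rpos_gt0 t0; rewrite lee_fin mulr_ge0 ?powR_ge0//.
  by case/andP: (g01 _ t0).
have [a0'|a0'] := ltP a 0.
  rewrite lt_eqF// epow_ge_neg// mule_ge0//.
  apply: integral_ge0 => t /Rpos_gt0 t0; rewrite lee_fin mulr_ge0 ?powR_ge0//.
  by rewrite subr_ge0; case/andP: (g01 _ t0).
have -> : a == 0 by rewrite eq_le a0 a0'.
case: (integral _ _ _) => [r| |].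
- rewrite -EFinM !lee_fin -expRN opprK -expRD.
  rewrite (_ : _ + (- _ + r) = r); last by ring.
  by rewrite -{1}(lnK s0) ler_expR.
- by rewrite gt0_muley ?lte_fin ?invr_gt0 ?expR_gt0// !leey.
- rewrite mule0 lee_fin leNgt s0/=; split => //.
Qed.

(** For a > 0: x and y are the integrals of g and h, n and p those of N and P. Here x and p may be
    infinite. *)
Lemma cancel_le (x n y p : \bar R) : y \is a fin_num -> n \is a fin_num ->
  (x + n = y + p)%E -> ((y <= x)%E <-> (n <= p)%E).
Proof.
move: x n y p => [x| |] [n| |] [y| |] [p| |]//= _ _.
- by rewrite -!EFinD !lee_fin => -[h]; split => ?; lra.
- by rewrite !leey.
Qed.

(** For a < 0: x and y are the integrals of 1 - g and 1 - h, and it is x and n that may be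
    infinite. *)
Lemma cancel_ge (x n y p : \bar R) : y \is a fin_num -> p \is a fin_num ->
  (x + p = y + n)%E -> ((x <= y)%E <-> (n <= p)%E).
Proof.
move: x n y p => [x| |] [n| |] [y| |] [p| |]//= _ _.
- by rewrite -!EFinD !lee_fin => -[h]; split => ?; lra.
- by rewrite !leNye.
Qed.

Definition expdecay (s t : R) : R := expR (- (t / s)).

Definition excess (g k : R -> R) (t : R) : R := Num.max (g t - k t) 0.

Definition power_integral (a : R) (k : R -> R) : \bar R :=
  (\int[mu]_(t in Rpos) (t `^ (a - 1) * k t)%:E)%E.

Lemma measurable_expdecay s : measurable_fun Rpos (expdecay s).
Proof. by apply: measurable_funTS; exact: measurable_expR_div. Qed.

Lemma expdecay_ge0 s t : 0 <= expdecay s t.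
Proof. exact: expR_ge0. Qed.

Lemma expdecay_bounds s t : 0 < s -> 0 < t -> 0 <= expdecay s t <= 1.
Proof.
move=> s0 t0; rewrite expdecay_ge0 -[leRHS]expR0 ler_expR.
by rewrite oppr_le0 divr_ge0 ?(ltW t0) ?(ltW s0).
Qed.

Lemma excess_ge0 g k t : 0 <= excess g k t.
Proof. by rewrite le_max lexx orbT. Qed.

Lemma measurable_excess g k : measurable_fun Rpos g -> measurable_fun Rpos k ->
  measurable_fun Rpos (excess g k).
Proof. by move=> mg mk; apply: measurable_maxr => //; exact: measurable_funB. Qed.

Lemma measurable_power_integrand a (k : R -> R) : measurable_fun Rpos k ->
  measurable_fun Rpos (fun t => (t `^ (a - 1) * k t)%:E).
Proof.
move=> mk; apply/measurable_EFinP; apply: measurable_funM => //.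
by apply: measurable_funTS; exact: measurable_powR.
Qed.

Lemma power_integral_ge0 a (k : R -> R) : (forall t, 0 < t -> 0 <= k t) ->
  (0 <= power_integral a k)%E.
Proof.
move=> k0; apply: integral_ge0 => t /Rpos_gt0 t0.
by rewrite lee_fin mulr_ge0 ?powR_ge0// k0.
Qed.

Lemma le_power_integral a (k k' : R -> R) :
  measurable_fun Rpos k -> measurable_fun Rpos k' ->
  (forall t, 0 < t -> 0 <= k t) -> (forall t, 0 < t -> k t <= k' t) ->
  (power_integral a k <= power_integral a k')%E.
Proof.
move=> mk mk' k0 kk'; apply: ge0_le_integral => //.
- by move=> t /Rpos_gt0 t0; rewrite lee_fin mulr_ge0 ?powR_ge0// k0.
- exact: measurable_power_integrand.
- exact: measurable_power_integrand.
- by move=> t /Rpos_gt0 t0; rewrite lee_fin ler_wpM2l ?powR_ge0// kk'.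
Qed.

Lemma power_integral_expdecay a s : 0 < s -> 0 < a ->
  (a%:E * power_integral a (expdecay s) = gamma_int a s)%E.
Proof.
move=> s0 a0; rewrite -gamma_int_pos// /power_integral -ge0_integralZl//.
- by apply: eq_integral => t _; rewrite -EFinM mulrA.
- by apply: measurable_power_integrand; exact: measurable_expdecay.
- by move=> t /Rpos_gt0 t0; rewrite lee_fin mulr_ge0 ?powR_ge0 ?expR_ge0.
- by rewrite lee_fin ltW.
Qed.

Lemma power_integral_1expdecay a s : 0 < s -> a < 0 ->
  (`|a|%:E * power_integral a (fun t => 1 - expdecay s t)%R = gamma_int a s)%E.
Proof.
move=> s0 a0; rewrite -gamma_int_neg// /power_integral -ge0_integralZl//.
- by apply: eq_integral => t _; rewrite -EFinM mulrA.
- apply: measurable_power_integrand; apply: measurable_funB => //.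
  exact: measurable_expdecay.
- move=> t /Rpos_gt0 t0; rewrite lee_fin mulr_ge0 ?powR_ge0// subr_ge0.
  by case/andP: (expdecay_bounds s0 t0).
Qed.

(** * Reduction to the positive and negative parts of g - h *)

Section Crossing.
Variables (g : R -> R) (s : R).
Hypothesis s0 : 0 < s.
Hypothesis mg : measurable_fun Rpos g.
Hypothesis g01 : forall t, 0 < t -> 0 <= g t <= 1.

Local Notation h := (expdecay s).
Local Notation P := (excess g (expdecay s)).
Local Notation N := (excess (expdecay s) g).
Local Notation w := (fun a t : R => t `^ (a - 1)).
Local Notation I := power_integral.

Let mh := measurable_expdecay s.
Let mP := measurable_excess mg mh.
Let mN := measurable_excess mh mg.
Let P0 := excess_ge0 g h.
Let N0 := excess_ge0 h g.
Let h01 t := @expdecay_bounds s t s0.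

Let PN t : g t + N t = h t + P t.
Proof. by rewrite /excess !maxEle; case: leP => ?; case: leP => ?; lra. Qed.

Let NleH t : 0 < t -> N t <= h t.
Proof.
move=> t0; rewrite ge_max; have /andP[-> _] := h01 t0.
by have /andP[] := g01 t0; lra.
Qed.

Let PleH t : 0 < t -> P t <= 1 - h t.
Proof.
move=> t0; rewrite ge_max; have /andP[_ h1] := h01 t0.
by have /andP[] := g01 t0; lra.
Qed.

Let I_add a (k k' : R -> R) : measurable_fun Rpos k -> measurable_fun Rpos k' ->
  (forall t, 0 < t -> 0 <= k t) -> (forall t, 0 < t -> 0 <= k' t) ->
  (I a k + I a k' = I a (fun t => k t + k' t)%R)%E.
Proof.
move=> mk mk' k0 k0'; rewrite /power_integral -ge0_integralD//.
- by apply: eq_integral => t _; rewrite -EFinD mulrDr.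
- by move=> t /Rpos_gt0 t0; rewrite lee_fin mulr_ge0 ?powR_ge0// k0.
- exact: measurable_power_integrand.
- by move=> t /Rpos_gt0 t0; rewrite lee_fin mulr_ge0 ?powR_ge0// k0'.
- exact: measurable_power_integrand.
Qed.

Let fin_scaled (c : R) (x : \bar R) (r : R) : 0 < c -> (0 <= x)%E ->
  (c%:E * x = r%:E)%E -> x \is a fin_num.
Proof. by move=> c0; case: x => [y| |]//; rewrite gt0_muley ?lte_fin. Qed.

(** Integrate g + N = h + P and cancel the finite terms. For a > 0 the integral of N is finite
    because N <= h; for a < 0 that of P is, because P <= 1 - h; for a = 0 the crossing point t0
    makes both finite, N being supported away from 0 and P on a bounded set. *)
Lemma above_crossing (a t0 : R) : -1 < a -> 0 < t0 ->
  (forall t, 0 < t -> t < t0 -> h t <= g t) -> (forall t, t0 < t -> g t <= h t) ->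
  (above a s g <-> (I a N <= I a P)%E).
Proof.
move=> a1 t00 gh hg; have Gfin := gamma_intE a1 s0.
rewrite /above.
have [a0|a0] := ltP 0 a.
  rewrite -power_integral_expdecay// lee_pmul2l ?lte_fin// -/(power_integral a g).
  have hfin : I a h \is a fin_num.
    apply: (@fin_scaled a _ (s `^ a * Gamma (a + 1))) => //;
      last by rewrite power_integral_expdecay.
    by apply: power_integral_ge0 => t _; exact: expR_ge0.
  apply: cancel_le => //.
    rewrite ge0_fin_numE; last by apply: power_integral_ge0 => t _; exact: N0.
    apply: le_lt_trans (le_power_integral _ mN mh _ NleH) _ => //; last by rewrite ltey_eq hfin.
  rewrite !I_add//; try (by move=> t _; exact: N0); try (by move=> t _; exact: P0).
  - by apply: eq_integral => t _; rewrite PN.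
  - by move=> t _; exact: expR_ge0.
  - by move=> t /g01 /andP[].
have mg1 : measurable_fun Rpos (fun t => 1 - g t) by exact: measurable_funB.
have mh1 : measurable_fun Rpos (fun t => 1 - h t) by exact: measurable_funB.
have [a0'|a0'] := ltP a 0.
  rewrite -power_integral_1expdecay// lee_pmul2l ?lte_fin ?normr_gt0 ?lt_eqF//.
  rewrite -/(power_integral a (fun t => 1 - g t)).
  have hfin : I a (fun t => 1 - h t) \is a fin_num.
    apply: (@fin_scaled `|a| _ (s `^ a * Gamma (a + 1)));
      rewrite ?normr_gt0 ?lt_eqF ?power_integral_1expdecay//.
    by apply: power_integral_ge0 => t /h01 /andP[_ ?]; lra.
  apply: cancel_ge => //.
    rewrite ge0_fin_numE; last by apply: power_integral_ge0 => t _; exact: P0.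
    apply: le_lt_trans (le_power_integral _ mP mh1 _ PleH) _ => //; last by rewrite ltey_eq hfin.
  rewrite !I_add//; try (by move=> t _; exact: N0); try (by move=> t _; exact: P0).
  - by apply: eq_integral => t _; congr ((_ * _)%:E); have := PN t; lra.
  - by move=> t /h01 /andP[_ ?]; lra.
  - by move=> t /g01 /andP[_ ?]; lra.
have {a0 a0'}aE : a = 0 by apply/eqP; rewrite eq_le a0 a0'.
have wE t : 0 < t -> t `^ (a - 1) = t^-1 by move=> tp; rewrite aE sub0r powR_inv1 ?ltW.
have IN : mu.-integrable Rpos (fun t => (t `^ (a - 1) * N t)%:E).
  apply/integrableP; split; first exact: measurable_power_integrand.
  (* N vanishes before t0, and after it 1/t <= 1/t0 and N <= h. *)
  apply: (@le_lt_trans _ _ (t0^-1%:E * I 1 h)%E); last first.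
    have m11 : (-1 : R) < 1 by lra.
    have := power_integral_expdecay s0 ltr01; rewrite (gamma_intE m11 s0) mul1e => ->.
    by rewrite -EFinM ltry.
  rewrite /power_integral -ge0_integralZl//; last 3 first.
  - exact: measurable_power_integrand.
  - by move=> t _; rewrite lee_fin mulr_ge0 ?powR_ge0 ?expR_ge0.
  - by rewrite lee_fin invr_ge0 ltW.
  apply: ge0_le_integral => //.
  - by apply: measurableT_comp => //; exact: measurable_power_integrand.
  - by apply: measurable_funeM; exact: measurable_power_integrand.
  move=> t /Rpos_gt0 tp; rewrite wE// -EFinM lee_fin ger0_norm; last first.
    by rewrite mulr_ge0 ?invr_ge0 ?(ltW tp).
  rewrite subrr powRr0 mul1r.
  have [tt0|tt0] := ltP t t0.
    have -> : N t = 0 by apply/max_idPr; rewrite subr_le0 gh.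
    by rewrite mulr0 mulr_ge0 ?expR_ge0 ?invr_ge0 ?(ltW t00).
  by apply: ler_pM; rewrite ?invr_ge0 ?(ltW tp)// ?NleH// lef_pV2 ?posrE.
have IP : mu.-integrable Rpos (fun t => (t `^ (a - 1) * P t)%:E).
  apply/integrableP; split; first exact: measurable_power_integrand.
  (* P vanishes after t0, and before it P(t)/t <= (1 - e^(-t/s))/t <= 1/s. *)
  apply: (@le_lt_trans _ _ (\int[mu]_(t in (`]0%R, t0]%classic : set R)) cst (s^-1)%:E t)%E);
    last first.
    by rewrite integral_cst//= lebesgue_measure_itv/= lte_fin t00 -EFinB -EFinM ltry.
  rewrite integral_mkcond [leRHS]integral_mkcond; apply: le_integral_setT => t.
    by apply: erestrict_ge0 => ? _; exact: abse_ge0.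
  rewrite !patchE; case: ifPn => [|_]; last first.
    case: ifPn => //= _; suff h0 : (0 <= (s^-1)%:E)%E by exact: h0.
    by rewrite lee_fin invr_ge0 ltW.
  rewrite inE => /Rpos_gt0 tp; rewrite wE//= ger0_norm; last first.
    by rewrite mulr_ge0 ?invr_ge0 ?(ltW tp).
  have [tt0|tt0] := leP t t0.
    rewrite mem_set/=; last by rewrite in_itv/= tp.
    rewrite lee_fin mulrC ler_pdivrMr//; apply: le_trans (PleH tp) _.
    have := expR_ge1Dx (- (t / s)); rewrite -/(expdecay s t) mulrC; lra.
  rewrite memNset/=; last by rewrite in_itv/= tp/=; apply/negP; rewrite -ltNge.
  have -> : P t = 0 by apply/max_idPr; rewrite subr_le0 hg.
  by rewrite mulr0.
have [Iq qE] := integrable_exp_difference s0.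
pose q (t : R) := ((h t - expR (- t)) / t)%:E.
have -> : (\int[mu]_(t in Rpos) ((g t - expR (- t)) / t)%:E =
    (ln s)%:E + I a P - I a N)%E.
  transitivity (\int[mu]_(t in Rpos) ((q t + (t `^ (a - 1) * P t)%:E) - (t `^ (a - 1) * N t)%:E))%E.
    apply: eq_integral => t; rewrite inE => /Rpos_gt0 tp.
    rewrite wE// -[RHS]/(((h t - expR (- t)) / t + t^-1 * P t - t^-1 * N t)%:E).
    congr EFin.
    have -> : g t = h t + P t - N t by have := PN t; lra.
    by ring.
  rewrite (@integralB _ (measurableTypeR R) R mu Rpos (measurable_itv _) _ _
     (@integrableD _ (measurableTypeR R) R mu Rpos (measurable_itv _) _ _ Iq IP) IN).
  rewrite (@integralD _ (measurableTypeR R) R mu Rpos (measurable_itv _) _ _ Iq IP).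
  by rewrite qE.
have fP : I a P \is a fin_num by exact: integrable_fin_num.
have fN : I a N \is a fin_num by exact: integrable_fin_num.
rewrite -(fineK fP) -(fineK fN).
rewrite -[X in (_ <= X)%E <-> _]/((ln s + fine (I a P) - fine (I a N))%:E).
by rewrite !lee_fin; split => ?; lra.
Qed.

End Crossing.

End Profiles.

(** * Monotonicity of the normalized radius in the order *)

Section ProfileComparison.
Variable R : realType.
Local Notation mu := (@lebesgue_measure R).
Local Notation Rpos := (`]0%R, +oo[%classic : set R).

Lemma above_mono (a s : R) (g g' : R -> R) :
  measurable_fun Rpos g -> measurable_fun Rpos g' ->
  (forall t, 0 < t -> 0 <= g t) -> (forall t, 0 < t -> g' t <= 1) ->
  (forall t, 0 < t -> g t <= g' t) -> above a s g -> above a s g'.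
Proof.
move=> mg mg' g0 g1 gg'; rewrite /above.
have [a0|a0] := ltP 0 a.
  move=> /le_trans; apply; rewrite lee_pmul2l ?lte_fin//.
  exact: (le_power_integral a mg mg' g0 gg').
have [a0'|a0'] := ltP a 0.
  apply: le_trans; rewrite lee_pmul2l ?lte_fin ?normr_gt0 ?lt_eqF//.
  apply: (@le_power_integral _ a (fun t => 1 - g' t) (fun t => 1 - g t)).
  - exact: measurable_funB.
  - exact: measurable_funB.
  - by move=> t /g1; rewrite subr_ge0.
  - by move=> t /gg' ?; rewrite lerD2l lerN2.
move=> /le_trans; apply.
have mf (k : R -> R) : measurable_fun Rpos k ->
    measurable_fun Rpos (fun t => ((k t - expR (- t)) / t)%:E).
  move=> mk; apply/measurable_EFinP; apply: measurable_funM.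
    apply: measurable_funB => //; apply: measurable_funTS.
    by apply: measurableT_comp => //.
  apply: (@eq_measurable_fun _ _ _ _ _ (fun t : R => t `^ (-1))).
    by move=> t; rewrite inE => /Rpos_gt0 t0; rewrite powR_inv1// ltW.
  by apply: measurable_funTS; exact: measurable_powR.
have ff t : Rpos t -> (((g t - expR (- t)) / t)%:E <= ((g' t - expR (- t)) / t)%:E)%E.
  move=> /Rpos_gt0 t0; rewrite lee_fin ler_pM2r ?invr_gt0//.
  by rewrite lerD2r gg'.
(* The integrand changes sign and may fail to be integrable, so its positive and negative parts are
   compared separately. *)
rewrite integralE [leRHS]integralE; apply: leeB.
- apply: ge0_le_integral => //.
  + exact: measurable_funepos (mf _ mg).
  + exact: measurable_funepos (mf _ mg').
  + by move=> t Dt; rewrite !funeposE ge_max !le_max ff//= lexx orbT.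
- apply: ge0_le_integral => //.
  + exact: measurable_funeneg (mf _ mg').
  + exact: measurable_funeneg (mf _ mg).
  + by move=> t Dt; rewrite !funenegE ge_max !le_max leeN2 ff//= lexx orbT.
Qed.

Lemma above_expdecay (a s s' : R) : -1 < a -> 0 < s -> 0 < s' ->
  (above a s (expdecay s') <-> s <= s').
Proof.
move=> a1 s0 s'0; have G0 := Gamma_gt0 a1.
have sa0 : 0 < s `^ a by rewrite powR_gt0.
have s'a0 : 0 < s' `^ a by rewrite powR_gt0.
rewrite /above; have [a0|a0] := ltP 0 a.
  rewrite -/(power_integral a (expdecay s')) power_integral_expdecay//.
  rewrite !gamma_intE// lee_fin ler_pM2r//; split => h.
    rewrite leNgt; apply/negP => h'.
    have := @gt0_ltr_powR _ _ a0 s' s; rewrite !nnegrE (ltW s0) (ltW s'0).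
    by move=> /(_ isT isT h'); rewrite ltNge h.
  by rewrite ge0_ler_powR ?nnegrE ?(ltW a0) ?(ltW s0) ?(ltW s'0).
have [a0'|a0'] := ltP a 0.
  rewrite -/(power_integral a (fun t => 1 - expdecay s' t)) power_integral_1expdecay//.
  rewrite !gamma_intE// lee_fin ler_pM2r//; split => h; last exact: powR_nonincreasing.
  rewrite leNgt; apply/negP => h'.
  have na0 : 0 < - a by rewrite oppr_gt0.
  have := @gt0_ltr_powR _ _ na0 s' s; rewrite !nnegrE (ltW s0) (ltW s'0).
  move=> /(_ isT isT h'); rewrite !powRN ltf_pV2 ?posrE//.
  by rewrite ltNge h.
have [_ E] := integrable_exp_difference s'0.
by rewrite /expdecay E lee_fin ler_ln ?posrE.
Qed.

(** The positive real minorants of the radius are exactly the numbers in ]0, s]. *)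
Lemma normalized_radius_expdecay (a s : R) : -1 < a -> 0 < s ->
  normalized_radius a (expdecay s) = s%:E.
Proof.
move=> a1 s0; have mh := measurable_expdecay s.
have h01 t := @expdecay_bounds _ s t s0.
have ge r : 0 < r -> ((r%:E <= normalized_radius a (expdecay s))%E <-> r <= s).
  by move=> r0; apply: iff_trans (normalized_radius_ge h01 a1 r0) (above_expdecay a1 r0 s0).
have := (ge s s0).2 (lexx s); case: (normalized_radius _ _) ge => [x| |]// ge.
- rewrite lee_fin => sx; congr EFin; apply/eqP; rewrite eq_le sx andbT.
  by apply/(ge x); rewrite ?lexx//; exact: lt_le_trans sx.
- move=> _; have h : 0 < s + 1 by lra.
  by have := (ge _ h).1 (leey _); rewrite leNgt ltrDl ltr01.
Qed.

(** The weight of order a is t^(a-b) times that of order b. This factor is at most t0^(a-b) where N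
    lives and at least t0^(a-b) where P lives, so the constant t0^(a-b) separates the two
    integrals. *)
Lemma le_power_integral_crossing (a b t0 : R) (N P : R -> R) : a < b -> 0 < t0 ->
  measurable_fun Rpos N -> measurable_fun Rpos P ->
  (forall t, 0 <= N t) -> (forall t, 0 <= P t) ->
  (forall t, 0 < t -> t < t0 -> N t = 0) -> (forall t, t0 < t -> P t = 0) ->
  (power_integral b N <= power_integral b P)%E ->
  (power_integral a N <= power_integral a P)%E.
Proof.
move=> ab t00 mN mP N0 P0 Nt Pt NP.
have ab0 : a - b < 0 by lra.
have c0 : 0 < t0 `^ (a - b) by rewrite powR_gt0.
have wE t : 0 < t -> t `^ (a - 1) = t `^ (a - b) * t `^ (b - 1).
  move=> t1; rewrite -powRD; last by rewrite (gt_eqF t1) implybT.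
  by congr (_ `^ _); lra.
have scale (k : R -> R) : measurable_fun Rpos k -> (forall t, 0 <= k t) ->
    ((t0 `^ (a - b))%:E * power_integral b k =
     \int[mu]_(t in Rpos) (t0 `^ (a - b) * (t `^ (b - 1) * k t))%:E)%E.
  move=> mk k0; rewrite /power_integral -ge0_integralZl//.
  - exact: measurable_power_integrand.
  - by move=> t _; rewrite lee_fin mulr_ge0 ?powR_ge0.
  - by rewrite lee_fin ltW.
have mscale (k : R -> R) : measurable_fun Rpos k ->
    measurable_fun Rpos (fun t => (t0 `^ (a - b) * (t `^ (b - 1) * k t))%:E).
  move=> mk; apply/measurable_EFinP; apply: measurable_funM => //.
  by apply/measurable_EFinP; exact: measurable_power_integrand.
apply: (@le_trans _ _ ((t0 `^ (a - b))%:E * power_integral b N)%E).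
  rewrite scale//; apply: ge0_le_integral => //.
  - by move=> t _; rewrite lee_fin mulr_ge0 ?powR_ge0.
  - exact: measurable_power_integrand.
  - exact: mscale.
  - move=> t /Rpos_gt0 t1; rewrite lee_fin wE// -mulrA.
    have [tt0|tt0] := ltP t t0; first by rewrite Nt// !mulr0.
    by rewrite ler_wpM2r ?mulr_ge0 ?powR_ge0// powR_nonincreasing.
apply: (@le_trans _ _ ((t0 `^ (a - b))%:E * power_integral b P)%E).
  by rewrite lee_pmul2l ?lte_fin.
rewrite scale//; apply: ge0_le_integral => //.
- by move=> t _; rewrite lee_fin !mulr_ge0 ?powR_ge0.
- exact: mscale.
- exact: measurable_power_integrand.
- move=> t /Rpos_gt0 t1; rewrite lee_fin wE// -mulrA.
  have [tt0|tt0] := leP t t0; last by rewrite Pt// !mulr0.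
  by rewrite ler_wpM2r ?mulr_ge0 ?powR_ge0// powR_nonincreasing.
Qed.

Section Profile.
Variable g : R -> R.
Hypothesis profile_g : profile g.

Let g_bounds t : 0 < t -> 0 <= g t <= 1.
Proof.
have [g0 gge gni _] := profile_g.
by move=> t0; rewrite gge -g0 gni// ltW.
Qed.

Lemma measurable_profile : measurable_fun Rpos g.
Proof.
have [_ _ gni _] := profile_g.
(* g decreases on the half-line; freezing it at g(0) on the left makes it monotone on the whole
   line. *)
apply: (@eq_measurable_fun _ _ _ _ _ (fun t : R => g (Num.max t 0) : R)).
  by move=> t; rewrite inE => /Rpos_gt0 t0; rewrite (max_idPl (ltW t0)).
apply: nonincreasing_measurable => // x y xy.
apply: gni; first by rewrite le_max lexx orbT.
by rewrite ge_max !le_max xy lexx !orbT.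
Qed.

(* log g is concave and log (expdecay s) is linear, and both vanish at 0. *)
Lemma profile_above_down (s t t' : R) : 0 < t -> t < t' ->
  expdecay s t' < g t' -> expdecay s t < g t.
Proof.
have [_ _ _ glc] := profile_g.
move=> t0 tt'; have t'0 : 0 < t' by exact: lt_trans tt'.
pose l := t / t'; have l0 : 0 < l by rewrite divr_gt0.
have l1 : l < 1 by rewrite ltr_pdivrMr// mul1r.
have tE : t = l * t' by rewrite divfK// gt_eqF.
move=> hg; have l01 : 0 < l < 1 by rewrite l0 l1.
have := glc t' l (ltW t'0) l01; rewrite -tE; apply: lt_le_trans.
have -> : expdecay s t = expdecay s t' `^ l.
  by rewrite /expdecay -expRM {1}tE; congr expR; ring.
by rewrite gt0_ltr_powR ?nnegrE ?expdecay_ge0// (le_trans (expdecay_ge0 s t'))// ltW.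
Qed.

Lemma normalized_radius_ge_of_lt (a b s : R) : -1 < a -> a < b -> 0 < s ->
  (s%:E < normalized_radius b g)%E -> (s%:E <= normalized_radius a g)%E.
Proof.
move=> a1 ab s0 sb; have b1 : -1 < b by exact: lt_trans ab.
have mg := measurable_profile; have mh := measurable_expdecay s.
have h01 t := @expdecay_bounds _ s t s0.
apply/(normalized_radius_ge g_bounds a1 s0).
have above_b : above b s g.
  by apply/(normalized_radius_ge g_bounds b1 s0); exact: ltW.
(* If g >= h throughout, the radius of g at a is at least that of h, which is s. *)
have [[t1 [t10 gh1]]|hg] := pselect (exists t, 0 < t /\ g t < expdecay s t); last first.
  apply: (@above_mono a s (expdecay s) g) => //.
  - by move=> t _; exact: expdecay_ge0.
  - by move=> t /g_bounds /andP[].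
  - by move=> t t0; rewrite leNgt; apply/negP => gh; apply: hg; exists t.
  - exact/above_expdecay.
(* If g <= h throughout, the radius of g at b is at most s, against the strict hypothesis: some s1 >
   s is still a minorant of it. *)
have [[t2 [t20 hg2]]|gh] := pselect (exists t, 0 < t /\ expdecay s t < g t); last first.
  exfalso; have [s1 [ss1 s1b]] : exists s1, s < s1 /\ (s1%:E <= normalized_radius b g)%E.
    move: sb; case: (normalized_radius b g) => [x| |]//.
      by rewrite lte_fin => sx; exists x.
    by move=> _; exists (s + 1); rewrite leey; split => //; lra.
  have s10 : 0 < s1 by exact: lt_trans ss1.
  have : above b s1 (expdecay s).
    apply: (@above_mono b s1 g) => //.
    - by move=> t /g_bounds /andP[].
    - by move=> t /h01 /andP[].
    - by move=> t t0; rewrite leNgt; apply/negP => hg; apply: gh; exists t.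
    - exact/(normalized_radius_ge g_bounds b1 s10).
  by move/(above_expdecay b1 s10 s0); rewrite leNgt ss1.
(* The crossing point is the supremum of T: T extends downwards to 0 by [profile_above_down], and
   for the same reason t1 bounds it. *)
pose T := [set t | 0 < t /\ expdecay s t < g t].
have T2 : T t2 by [].
have Tub : ubound T t1.
  move=> t [t0 ht]; rewrite leNgt; apply/negP => t1t.
  by have := profile_above_down t10 t1t ht; rewrite ltNge (ltW gh1).
have Tsup : has_sup T by split; [exists t2|exists t1].
have t00 : 0 < sup T by apply: (lt_le_trans t20); apply: ub_le_sup => //; exists t1.
have below t : 0 < t -> t < sup T -> expdecay s t <= g t.
  move=> t0 /(sup_gt Tsup.1)[t' [_ ht'] tt'].
  exact: ltW (profile_above_down t0 tt' ht').
have after t : sup T < t -> g t <= expdecay s t.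
  move=> tt; have t0 : 0 < t by exact: lt_trans tt.
  rewrite leNgt; apply/negP => ht; move: tt; apply/negP; rewrite -leNgt.
  by apply: ub_le_sup; [exists t1|split].
apply/(above_crossing s0 mg g_bounds a1 t00 below after).
apply: (le_power_integral_crossing ab t00).
- exact: measurable_excess.
- exact: measurable_excess.
- exact: excess_ge0.
- exact: excess_ge0.
- by move=> t t0 tt; apply/max_idPr; rewrite subr_le0 below.
- by move=> t tt; apply/max_idPr; rewrite subr_le0 after.
- exact/(above_crossing s0 mg g_bounds b1 t00 below after).
Qed.

Lemma normalized_radius_ge0 (a : R) : (0 <= normalized_radius a g)%E.
Proof.
rewrite /normalized_radius; apply: mule_ge0.
  by rewrite lee_fin invr_ge0 /Gfac; case: ifP; rewrite ?expR_ge0 ?powR_ge0.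
have epow_ge0 (x : \bar R) p : (0 <= epow x p)%E.
  case: x => [r| |] //=; last by case: ifP.
  by case: ifP => _; [case: ifP|rewrite lee_fin powR_ge0].
rewrite /profile_radius; case: ifP => _; first exact: epow_ge0.
case: ifP => _; first exact: epow_ge0.
by case: (integral _ _ _) => [r| |]//; rewrite lee_fin expR_ge0.
Qed.

(** A real strictly between the two radii would be a minorant of the one at b but not of the one at
    a. *)
Lemma normalized_radius_nonincreasing (a b : R) : -1 < a -> a < b ->
  (normalized_radius b g <= normalized_radius a g)%E.
Proof.
move=> a1 ab; rewrite leNgt; apply/negP => lt_ab.
have key s : 0 < s -> (s%:E < normalized_radius b g)%E -> (s%:E <= normalized_radius a g)%E.
  exact: normalized_radius_ge_of_lt.
have := normalized_radius_ge0 a.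
case: (normalized_radius a g) lt_ab key => [x| |]//; last by rewrite ltNge leey.
rewrite lee_fin => + + x0.
case: (normalized_radius b g) => [y| |]//.
- rewrite lte_fin => xy key; have [xm my] := midf_lt xy.
  have := key _ (le_lt_trans x0 xm); rewrite lte_fin => /(_ my).
  by rewrite lee_fin leNgt xm.
- move=> _ key; have h : 0 < x + 1 by lra.
  by have := key _ h (ltry _); rewrite lee_fin leNgt ltrDl ltr01.
Qed.

End Profile.
End ProfileComparison.

(** * Radial mean bodies in terms of the normalized covariogram *)

Section RadialFunction.
Variable R : realType.
Local Notation mu := (@lebesgue_measure R).
Local Notation Rpos := (`]0%R, +oo[%classic : set R).

Lemma rho_profile n (a : R) (f : 'rV[R]_n -> R) (xi : 'rV[R]_n) : rlc f ->
  (0 < L2sq f < +oo)%E -> rho a f xi = profile_radius a (ncov f xi).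
Proof.
move=> Lf fL2; have nf0 : 0 < fine (L2sq f) by exact: fine_gt0.
have pg := profile_ncov xi Lf fL2; have mg := measurable_profile pg.
have [g0 gge gni _] := pg.
rewrite /rho /profile_radius; have [a0|a0] := ltP 0 a.
  congr epow; transitivity ((a / fine (L2sq f))%:E *
      ((fine (L2sq f))%:E * power_integral a (ncov f xi)))%E; last first.
    by rewrite muleA -EFinM divfK ?gt_eqF.
  congr (_ * _)%E; rewrite /power_integral -ge0_integralZl//.
  - by apply: eq_integral => t _; rewrite (gcov_ncov _ Lf fL2) -!EFinM mulrCA.
  - exact: measurable_power_integrand.
  - by move=> t _; rewrite lee_fin mulr_ge0 ?powR_ge0.
  - by rewrite lee_fin ltW.
case: ifPn => a0'; last first.
  congr (match _ with _%:E => _ | +oo%E => _ | -oo%E => _ end).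
  apply: eq_integral => t _; rewrite (gcov_ncov _ Lf fL2)/=.
  by rewrite (mulrC (fine _)) mulfK ?gt_eqF// mulrC.
congr epow; transitivity ((`|a| / (2 * fine (L2sq f)))%:E *
    ((2 * fine (L2sq f))%:E * power_integral a (fun t => 1 - ncov f xi t)%R))%E; last first.
  by rewrite muleA -EFinM divfK// mulf_neq0// gt_eqF.
congr (_ * _)%E; rewrite /power_integral -ge0_integralZl//.
- by apply: eq_integral => t _; rewrite (gdiff_ncov _ Lf fL2) -!EFinM mulrCA.
- by apply: measurable_power_integrand; exact: measurable_funB.
- move=> t /Rpos_gt0 t0; rewrite lee_fin mulr_ge0 ?powR_ge0// subr_ge0.
  by rewrite -g0 gni// ltW.
- by rewrite lee_fin mulr_ge0 ?ltW.
Qed.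

Lemma eq_profile_radius (a : R) (g g' : R -> R) : (forall t, 0 < t -> g t = g' t) ->
  profile_radius a g = profile_radius a g'.
Proof.
move=> gg'; rewrite /profile_radius; case: ifP => _.
  congr (epow (_ * _)%E _); apply: eq_integral => t; rewrite inE => /Rpos_gt0 t0.
  by rewrite gg'.
case: ifP => _.
  congr (epow (_ * _)%E _); apply: eq_integral => t; rewrite inE => /Rpos_gt0 t0.
  by rewrite gg'.
congr (match _ with _%:E => _ | +oo%E => _ | -oo%E => _ end).
apply: eq_integral => t; rewrite inE => /Rpos_gt0 t0.
by rewrite gg'.
Qed.

End RadialFunction.

(** * Exponentials of simplex gauges *)

Section SimplexExponential.
Variable R : realType.
Local Notation mu := (@lebesgue_measure R).

Lemma iint_scale n (k : R) (F : 'rV[R]_n -> \bar R) : 0 <= k -> elc F ->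
  iint (fun x => k%:E * F x)%E = (k%:E * iint F)%E.
Proof.
elim: n F => [|n IH] F k0 LF //=.
have LM := elc_marginal LF.
rewrite -ge0_integralZl//.
- by apply: eq_integral => x _; rewrite -(IH _ k0 (elc_slice x LF)).
- exact: elc_measurable LM.
- by move=> x _; exact: LM.1.
Qed.

Lemma row_mx_ord0 n (x : R) (v : 'rV[R]_n) :
  (row_mx (const_mx x : 'rV[R]_1) v : 'rV[R]_n.+1) ord0 ord0 = x.
Proof. by rewrite mxE; case: splitP => // k _; rewrite mxE. Qed.

Lemma row_mx_lift n (x : R) (v : 'rV[R]_n) (j : 'I_n) :
  (row_mx (const_mx x : 'rV[R]_1) v : 'rV[R]_n.+1) ord0 (lift ord0 j) = v ord0 j.
Proof.
rewrite mxE; case: splitP => k /=; first by rewrite ord1.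
by rewrite /bump add1n => -[jk]; congr (v _ _); exact/val_inj.
Qed.

Lemma slice_coord n (x : R) (v : 'rV[R]_n) (F : R -> R) :
  \sum_(j < n.+1) F ((row_mx (const_mx x : 'rV[R]_1) v : 'rV[R]_n.+1) ord0 j) =
  F x + \sum_(j < n) F (v ord0 j).
Proof.
rewrite big_ord_recl row_mx_ord0; congr (_ + _).
by apply: eq_bigr => j _; rewrite row_mx_lift.
Qed.

Lemma integral_laplace_finite (e : R) : 0 < e ->
  (\int[mu]_(x in [set: R]) (expR (- (e * `|x|)))%:E < +oo)%E.
Proof.
move=> e0; have ei0 : 0 < e^-1 by rewrite invr_gt0.
rewrite ge0_symfun_integralT; last 3 first.
- by move=> x; exact: expR_ge0.
- move=> x; apply: continuous_comp; last exact: continuous_expR.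
  by apply: cvgN; apply: cvgM; [exact: cvg_cst|exact: norm_continuous].
- by move=> x /=; rewrite normrN.
rewrite (_ : integral _ _ _ = (e^-1)%:E); first by rewrite -EFinM ltry.
rewrite (_ : [set x : R | 0 <= x] = `[0%R, +oo[%classic); last first.
  by apply/seteqP; split => x /=; rewrite in_itv/= andbT.
rewrite -integral_itv_obnd_cbnd; last first.
  apply/measurable_EFinP; apply: measurable_funTS.
  apply: measurableT_comp => //; apply: measurableT_comp => //.
  by apply: measurable_funM => //; exact: measurableT_comp.
transitivity ((e^-1)%:E * \int[mu]_(x in `]0%R, +oo[) (e^-1^-1 * expR (- (x / e^-1)))%:E)%E.
  rewrite -ge0_integralZl//; last 3 first.
  - by apply/measurable_EFinP; apply: measurable_funTS; exact: measurable_expR_scale.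
  - by move=> x _; rewrite lee_fin mulr_ge0 ?expR_ge0// invrK ltW.
  - by rewrite lee_fin ltW.
  apply: eq_integral => x; rewrite inE/= in_itv/= andbT => x0.
  rewrite -EFinM invrK mulrA mulVf ?gt_eqF// mul1r gtr0_norm//.
  by rewrite (mulrC e).
by rewrite integral_expR_tail// mul0r oppr0 expR0 mule1.
Qed.

(** The bound is a product of functions of one coordinate. With [iint_box] below, it shows that the
    exponential of a simplex gauge has a finite non-zero norm. *)
Lemma iint_exp_bound n (e C : R) (F : 'rV[R]_n -> \bar R) : 0 < e -> 0 <= C ->
  (forall x, 0 <= F x)%E ->
  (forall x, F x <= (C * expR (- (e * \sum_(j < n) `|x ord0 j|)))%:E)%E ->
  (iint F < +oo)%E.
Proof.
move=> e0; pose J := fine (\int[mu]_(x in [set: R]) (expR (- (e * `|x|)))%:E)%E.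
have JE : (\int[mu]_(x in [set: R]) (expR (- (e * `|x|)))%:E = J%:E)%E.
  rewrite fineK// ge0_fin_numE ?integral_laplace_finite//.
  by apply: integral_ge0 => x _; rewrite lee_fin expR_ge0.
(* The explicit bound carries the induction, C absorbing the exponential of the outer coordinate. *)
suff H : 0 <= C -> (forall x, 0 <= F x)%E ->
  (forall x, F x <= (C * expR (- (e * \sum_(j < n) `|x ord0 j|)))%:E)%E ->
  (iint F <= (C * J ^+ n)%:E)%E.
  by move=> C0 F0 FC; apply: le_lt_trans (H C0 F0 FC) _; rewrite ltry.
elim: n C F => [|n IH] C F C0 F0 FC.
  by have := FC 0; rewrite big_ord0 mulr0 oppr0 expR0 expr0.
rewrite iintS.
apply: (@le_trans _ _ (\int[mu]_(x in [set: R]) ((C * J ^+ n)%:E * (expR (- (e * `|x|)))%:E))%E).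
  apply: le_integral_setT => x; first by apply: iint_ge0 => v; exact: F0.
  rewrite -EFinM mulrAC; apply: IH.
  - by rewrite mulr_ge0 ?expR_ge0.
  - by move=> v; exact: F0.
  - move=> v; apply: le_trans (FC _) _; rewrite lee_fin.
    rewrite (slice_coord x v (fun y => `|y|)) -mulrA -expRD mulrDr opprD.
    exact: lexx.
have mexp : measurable_fun [set: R] (fun x : R => (expR (- (e * `|x|)))%:E).
  apply/measurable_EFinP; apply: measurableT_comp => //; apply: measurableT_comp => //.
  by apply: measurable_funM => //; exact: measurableT_comp.
rewrite ge0_integralZl//; last first.
  rewrite lee_fin mulr_ge0 ?exprn_ge0// -lee_fin -JE.
  by apply: integral_ge0 => x _; rewrite lee_fin expR_ge0.
by rewrite JE -EFinM -mulrA -exprSr.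
Qed.

Lemma iint_box n (r d : R) (p : 'rV[R]_n) (F : 'rV[R]_n -> \bar R) : 0 < r -> 0 <= d ->
  (forall x, 0 <= F x)%E ->
  (forall x : 'rV[R]_n, (forall j, `|x ord0 j - p ord0 j| <= r) -> (d%:E <= F x)%E) ->
  ((d * (2 * r) ^+ n)%:E <= iint F)%E.
Proof.
move=> r0; elim: n d p F => [|n IH] d p F d0 F0 Fd.
  by rewrite expr0 mulr1; apply: Fd => -[].
pose p0 := p ord0 ord0; pose q : 'rV[R]_n := \row_j p ord0 (lift ord0 j).
have rr : p0 - r < p0 + r by lra.
have -> : (d * (2 * r) ^+ n.+1)%:E =
    (\int[mu]_(x in (`[(p0 - r)%R, (p0 + r)%R]%classic : set R)) cst (d * (2 * r) ^+ n)%:E x)%E.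
  rewrite integral_cst//= lebesgue_measure_itv/= lte_fin rr -EFinB -EFinM.
  by congr EFin; rewrite exprSr; ring.
rewrite iintS integral_mkcond; apply: le_integral_setT => x.
  apply: erestrict_ge0 => ? _; rewrite lee_fin mulr_ge0// exprn_ge0// mulr_ge0//.
  exact: ltW.
rewrite patchE; case: ifPn => [|_]; last by apply: iint_ge0 => v; exact: F0.
rewrite inE/= in_itv/= => /andP[px xp].
apply: (IH d q) => // [v|v vq]; first exact: F0.
apply: Fd => j; case: (unliftP ord0 j) => [i ->|->].
  by rewrite row_mx_lift; have := vq i; rewrite mxE.
by rewrite row_mx_ord0 -/p0 ler_norml; lra.
Qed.

End SimplexExponential.

(** * The gauge of a simplex and the equality case *)

Section SimplexGauge.
Variables (R : realType) (n : nat) (V : 'M[R]_n).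
Hypothesis V_unit : V \in unitmx.

Let bary (x : 'rV[R]_n) : 'rV[R]_n := x *m invmx V.

Let baryK x : bary x *m V = x.
Proof. by rewrite /bary -mulmxA mulVmx// mulmx1. Qed.

Let bary_mul x : bary (x *m V) = x.
Proof. by rewrite /bary -mulmxA mulmxV// mulmx1. Qed.

(** Closed form of e^(-|x|) for the gauge of the simplex: the row x V^(-1) holds the coordinates of
    x in the basis of the vertices other than the origin, and the gauge is their sum on the cone
    where all are non-negative, +oo elsewhere. *)
Definition cone_exp (x : 'rV[R]_n) : R :=
  if [forall i, 0 <= (x *m invmx V) ord0 i]
  then expR (- \sum_(i < n) (x *m invmx V) ord0 i) else 0.

Lemma gauge_simplex0 x : gauge (simplex0 V) x =
  if [forall i, 0 <= (x *m invmx V) ord0 i]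
  then (\sum_(i < n) (x *m invmx V) ord0 i)%:E else +oo%E.
Proof.
rewrite /gauge; set S := [set _ | _ in _].
have inS (l : R) : 0 < l -> (forall i, 0 <= bary x ord0 i) ->
    \sum_(i < n) bary x ord0 i <= l -> S l%:E.
  move=> l0 x0 xl; exists l => //=; split => //; exists (l^-1 *: x); last first.
    by rewrite scalerA divff ?scale1r// gt_eqF.
  exists (l^-1 *: bary x); split=> [i|]; first by rewrite mxE mulr_ge0 ?invr_ge0 ?(ltW l0).
  split; last by rewrite -scalemxAl baryK.
  under eq_bigr do rewrite mxE.
  by rewrite -mulr_sumr mulrC ler_pdivrMr ?mul1r.
have Sin y : S y -> exists l : R, [/\ y = l%:E, 0 < l, forall i, 0 <= bary x ord0 i
    & \sum_(i < n) bary x ord0 i <= l].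
  move=> [l [l0 [z [lam [lam0 [lam1 ->]]] xE]] <-]; exists l.
  have bE : bary x = l *: lam by rewrite xE scalemxAl bary_mul.
  split => // [i|]; first by rewrite bE mxE mulr_ge0 ?(ltW l0).
  rewrite bE; under eq_bigr do rewrite mxE.
  by rewrite -mulr_sumr -[leRHS]mulr1 ler_pM2l.
case: ifPn => [/forallP x0|x0]; last first.
  suff -> : S = set0 by rewrite ereal_inf0.
  apply/seteqP; split => // y /Sin[l [_ _ h _]].
  by move/forallP: x0; apply.
apply/eqP; rewrite eq_le; apply/andP; split; last first.
  by apply: le_ereal_inf_tmp => y /Sin[l [-> _ _ h]]; rewrite lee_fin.
have s0 : 0 <= \sum_(i < n) bary x ord0 i by apply: sumr_ge0 => i _; exact: x0.
(* The sum itself may be inadmissible: at x = 0 it is 0, while the gauge asks for l > 0. *)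
apply/lee_addgt0Pr => e e0; apply: ereal_inf_lbound; rewrite -EFinD.
apply: inS => //; first exact: ltr_wpDl.
by rewrite lerDl ltW.
Qed.

Lemma expeR_gauge x : fine (expeR (- gauge (simplex0 V) x)) = cone_exp x.
Proof. by rewrite gauge_simplex0 /cone_exp; case: ifP. Qed.

Lemma cone_exp_ge0 x : 0 <= cone_exp x.
Proof. by rewrite /cone_exp; case: ifP; rewrite ?expR_ge0. Qed.

Lemma rlc_cone_exp (c : R) (x0 : 'rV[R]_n) : 0 < c ->
  rlc (fun x => c * cone_exp (x - x0)).
Proof.
move=> c0; split=> [x|x y l l01]; first by rewrite mulr_ge0 ?cone_exp_ge0// ltW.
have [l0 l1] := andP l01; have l1' : 0 < 1 - l by lra.
rewrite !powRM ?cone_exp_ge0 ?(ltW c0)// mulrACA -powRD; last first.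
  by rewrite (gt_eqF c0) implybT.
rewrite [l + _]addrC subrK powRr1 ?(ltW c0)// ler_pM2l//.
have -> : l *: x + (1 - l) *: y - x0 = l *: (x - x0) + (1 - l) *: (y - x0).
  by rewrite !scalerBr addrACA -opprD comb_id.
move: (x - x0) (y - x0) => u v.
rewrite {1}/cone_exp; case: ifP => [/forallP u0|_]; last first.
  by rewrite powR0 ?gt_eqF// mul0r cone_exp_ge0.
rewrite {1}/cone_exp; case: ifP => [/forallP v0|_]; last first.
  by rewrite [X in _ * X]powR0 ?gt_eqF// mulr0 cone_exp_ge0.
have bE i : ((l *: u + (1 - l) *: v) *m invmx V) ord0 i =
    l * (u *m invmx V) ord0 i + (1 - l) * (v *m invmx V) ord0 i.
  by rewrite mulmxDl -!scalemxAl !mxE.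
rewrite /cone_exp ifT; last first.
  by apply/forallP => i; rewrite bE addr_ge0// mulr_ge0 ?(ltW l0) ?(ltW l1').
rewrite -!expRM -expRD ler_expR; under [in leRHS]eq_bigr do rewrite bE.
by rewrite big_split/= -!mulr_sumr opprD !mulNr [l * _]mulrC [(1 - l) * _]mulrC.
Qed.

(* The cones C and C - t xi meet in C + t p, where p has barycentric coordinates
   max(-mu_i, 0), mu_i being those of xi. *)
Lemma cone_exp_mul_shift (x xi : 'rV[R]_n) (t : R) : 0 <= t ->
  cone_exp x * cone_exp (x + t *: xi) =
  expR (- (t * \sum_(i < n) `|(xi *m invmx V) ord0 i|)) *
  cone_exp (x - t *: ((\row_i Num.max (- (xi *m invmx V) ord0 i) 0) *m V)) ^+ 2.
Proof.
move=> t0; set m := \row_i _.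
have b1 i : ((x + t *: xi) *m invmx V) ord0 i =
    (x *m invmx V) ord0 i + t * (xi *m invmx V) ord0 i.
  by rewrite mulmxDl -scalemxAl !mxE.
have b2 i : ((x - t *: (m *m V)) *m invmx V) ord0 i =
    (x *m invmx V) ord0 i - t * Num.max (- (xi *m invmx V) ord0 i) 0.
  by rewrite mulmxBl -scalemxAl -(mulmxA m) mulmxV// mulmx1 !mxE.
(* Coordinatewise, la >= t max(-mu, 0) holds exactly when la >= 0 and la + t mu >= 0. *)
have pos i : (0 <= ((x - t *: (m *m V)) *m invmx V) ord0 i) =
    (0 <= (x *m invmx V) ord0 i) && (0 <= ((x + t *: xi) *m invmx V) ord0 i).
  rewrite b1 b2; set la := (x *m _) _ _; set mui := (xi *m _) _ _.
  rewrite maxEle; case: ifPn => h.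
    rewrite mulr0 subr0; case: leP => //= la0.
    by apply/esym; rewrite addr_ge0// mulr_ge0// -oppr_le0.
  rewrite -ltNge in h; rewrite mulrN opprK.
  case: (leP 0 la) => //= la0; apply/negbTE; rewrite -ltNge.
  have : t * mui <= 0 by rewrite mulr_ge0_le0// ltW// -oppr_gt0.
  by move: (t * mui) => z; lra.
rewrite /cone_exp.
have [/forallP h|h] := boolP [forall i, 0 <= ((x - t *: (m *m V)) *m invmx V) ord0 i].
  have [h1 h2] : (forall i, 0 <= (x *m invmx V) ord0 i) /\
      (forall i, 0 <= ((x + t *: xi) *m invmx V) ord0 i).
    by split=> i; have := h i; rewrite pos => /andP[].
  rewrite (introT forallP h1) (introT forallP h2).
  rewrite expr2 -!expRD; congr expR.
  rewrite -!opprD mulr_sumr -!big_split/=; congr (- _).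
  (* The exponents agree by 2 la + t mu = t |mu| + 2 (la - t max(-mu, 0)), checked for each sign of
     mu. *)
  apply: eq_bigr => i _; rewrite b1 b2.
  set la := (x *m _) _ _; set mui := (xi *m _) _ _.
  rewrite maxEle; case: ifPn => hm.
    by rewrite ger0_norm -?oppr_le0//; ring.
  rewrite -ltNge oppr_gt0 in hm; rewrite ltr0_norm//; ring.
rewrite expr0n/= mulr0; case: ifP => [/forallP h1|_]; last by rewrite mul0r.
case: ifP => [/forallP h2|_]; last by rewrite mulr0.
by move/forallP: h; case=> i; rewrite pos h1 h2.
Qed.

Lemma cone_exp_sqr_bound : exists e : R, 0 < e /\
  forall x, cone_exp x ^+ 2 <= expR (- (e * \sum_(j < n) `|x ord0 j|)).
Proof.
(* x is the combination of the rows of V with coefficients la_i >= 0, so its l1 norm is at most M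
   times their sum; the added 1 keeps M positive in dimension 0. *)
pose M := 1 + \sum_(i < n) \sum_(j < n) `|V i j|.
have S0 : 0 <= \sum_(i < n) \sum_(j < n) `|V i j|.
  by apply: sumr_ge0 => i _; apply: sumr_ge0.
have M0 : 0 < M by rewrite ltr_pwDl.
exists M^-1; split => [|x]; first by rewrite invr_gt0.
rewrite /cone_exp; case: ifP => [/forallP x0|_]; last by rewrite expr0n expR_ge0.
rewrite expr2 -expRD ler_expR -opprD lerN2 mulrC ler_pdivrMr//.
set la := x *m invmx V.
have s0 : 0 <= \sum_(i < n) la ord0 i by apply: sumr_ge0 => i _; exact: x0.
apply: (@le_trans _ _ ((\sum_(i < n) la ord0 i) * M)); last first.
  by rewrite ler_pM2r// lerDl.
apply: (@le_trans _ _ (\sum_(j < n) \sum_(i < n) la ord0 i * `|V i j|)).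
  apply: ler_sum => j _; rewrite -{1}(baryK x) mxE.
  apply: le_trans (ler_norm_sum _ _ _) _; apply: ler_sum => i _.
  by rewrite normrM ger0_norm// x0.
rewrite exchange_big/= mulr_suml; apply: ler_sum => i _.
rewrite -mulr_sumr ler_wpM2l ?x0// /M [X in _ <= 1 + X](bigD1 i)//=.
rewrite addrCA lerDl addr_ge0//.
by apply: sumr_ge0 => k _; apply: sumr_ge0.
Qed.

Lemma cone_exp_sqr_box : exists (r d : R) (p : 'rV[R]_n), [/\ 0 < r, 0 < d &
  forall x : 'rV[R]_n, (forall j, `|x ord0 j - p ord0 j| <= r) -> d <= cone_exp x ^+ 2].
Proof.
pose W := invmx V; pose M := 1 + \sum_(i < n) \sum_(j < n) `|W j i|.
have S0 : 0 <= \sum_(i < n) \sum_(j < n) `|W j i|.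
  by apply: sumr_ge0 => i _; apply: sumr_ge0.
have M0 : 0 < M by rewrite ltr_pwDl.
(* All coordinates of p in the basis of vertices are 1. The radius 1/M moves each by at most 1, so
   on the box they lie in [0, 2] and their sum is at most 2n. *)
pose p := (const_mx 1 : 'rV[R]_n) *m V.
exists M^-1, (expR (- (2 * n%:R)) ^+ 2), p.
split => [||x xp]; rewrite ?invr_gt0 ?exprn_gt0 ?expR_gt0//.
have near1 i : `|(x *m invmx V) ord0 i - 1| <= 1.
  have -> : (x *m invmx V) ord0 i - 1 = \sum_(j < n) (x - p) ord0 j * W j i.
    have -> : 1 = bary p ord0 i by rewrite bary_mul mxE.
    rewrite /bary -[RHS](_ : ((x - p) *m W) ord0 i = _); last by rewrite mxE.
    by rewrite mulmxBl !mxE.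
  apply: le_trans (ler_norm_sum _ _ _) _.
  apply: (@le_trans _ _ (\sum_(j < n) M^-1 * `|W j i|)).
    apply: ler_sum => j _; rewrite normrM ler_wpM2r//.
    suff -> : (x - p) ord0 j = x ord0 j - p ord0 j by exact: xp.
    by rewrite !mxE.
  rewrite -mulr_sumr mulrC ler_pdivrMr// mul1r /M [X in _ <= 1 + X](bigD1 i)//=.
  rewrite addrCA lerDl addr_ge0//.
  by apply: sumr_ge0 => k _; apply: sumr_ge0.
have b02 i : 0 <= (x *m invmx V) ord0 i <= 2.
  by have := near1 i; rewrite ler_norml => /andP[? ?]; apply/andP; split; lra.
rewrite lerXn2r ?nnegrE ?expR_ge0 ?cone_exp_ge0// /cone_exp ifT; last first.
  by apply/forallP => i; case/andP: (b02 i).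
rewrite ler_expR lerN2 mulrC mulr_natl -[leRHS](_ : \sum_(i < n) 2 = _); last first.
  by rewrite sumr_const card_ord.
by apply: ler_sum => i _; case/andP: (b02 i).
Qed.

Section SimplexExponential.
Variables (c : R) (x0 xi : 'rV[R]_n).
Hypothesis c_gt0 : 0 < c.
Let f (x : 'rV[R]_n) := c * cone_exp (x - x0).

Let rlc_f : rlc f. Proof. exact: rlc_cone_exp. Qed.

Let L2sq_f : L2sq f = iint (fun x => (c ^+ 2 * cone_exp x ^+ 2)%:E).
Proof.
rewrite L2sqE -(cov_shift _ _ x0 rlc_f) add0r; congr iint; apply/funext => x.
by rewrite /f addrK; congr EFin; ring.
Qed.

Lemma L2sq_cone_exp : (0 < L2sq f < +oo)%E.
Proof.
rewrite L2sq_f; have F0 x : (0 <= (c ^+ 2 * cone_exp x ^+ 2)%:E)%E.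
  by rewrite lee_fin mulr_ge0 ?exprn_ge0 ?cone_exp_ge0// ltW.
have c20 : 0 < c ^+ 2 by rewrite exprn_gt0.
apply/andP; split.
  have [r [d [p [r0 d0 Hd]]]] := cone_exp_sqr_box.
  apply: (@lt_le_trans _ _ (c ^+ 2 * d * (2 * r) ^+ n)%:E).
    by rewrite lte_fin !mulr_gt0 ?exprn_gt0// mulr_gt0.
  apply: (iint_box r0 _ F0 (p := p)); first by rewrite mulr_ge0// ltW.
  by move=> x xp; rewrite lee_fin ler_pM2l// Hd.
have [e [e0 He]] := cone_exp_sqr_bound.
apply: (iint_exp_bound e0 (ltW c20) F0) => x.
by rewrite lee_fin ler_pM2l.
Qed.

Lemma ncov_cone_exp (t : R) : 0 <= t ->
  ncov f xi t = expR (- (t * \sum_(i < n) `|(xi *m invmx V) ord0 i|)).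
Proof.
move=> t0; rewrite /ncov; set k := expR _.
have k0 : 0 <= k by exact: expR_ge0.
suff -> : gcov f xi t = (k%:E * L2sq f)%E.
  have /andP[L0 Li] := L2sq_cone_exp.
  rewrite fineM//; last by rewrite ge0_fin_numE// ltW.
  by rewrite /= mulfK// gt_eqF// fine_gt0// L0 Li.
pose w := - x0 - t *: ((\row_i Num.max (- (xi *m invmx V) ord0 i) 0) *m V).
pose G x := (c ^+ 2 * cone_exp x ^+ 2)%:E.
(* G is, up to translation, the square of f, so [elc_mul] applies to it. *)
have LG z : elc (fun x => G (x + z)).
  have := elc_mul (z + x0) (z + x0) rlc_f; congr elc; apply/funext => x.
  by rewrite /f /G addrA addrK; congr EFin; ring.
have LG0 : elc G.
  by have := LG 0; congr elc; apply/funext => x; rewrite addr0.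
rewrite L2sq_f -(iint_shift w LG0) -iint_scale//.
rewrite /gcov; congr iint; apply/funext => x; rewrite /G -EFinM; congr EFin.
have -> : f x * f (x + t *: xi) = c ^+ 2 * (cone_exp (x - x0) * cone_exp (x - x0 + t *: xi)).
  by rewrite /f (addrAC x (t *: xi)); ring.
rewrite (cone_exp_mul_shift _ _ t0) -/k /w (addrA x); ring.
Qed.

End SimplexExponential.

End SimplexGauge.

Theorem theorem19 (R : realType) (n : nat) :
  (forall f : 'rV[R]_n -> R,
     log_concave f -> (0 < L2sq f < +oo)%E ->
     forall a b : R, -1 < a -> a < b ->
     forall xi, sphere xi ->
       ((Gfac b)^-1%:E * rho b f xi <= (Gfac a)^-1%:E * rho a f xi)%E) /\
  (forall (c : R) (x0 : 'rV[R]_n) (V : 'M[R]_n) (f : 'rV[R]_n -> R),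
     0 < c -> V \in unitmx ->
     (forall x, f x = c * fine (expeR (- gauge (simplex0 V) (x - x0)))) ->
     forall a b : R, -1 < a -> a < b ->
     forall xi, sphere xi ->
       ((Gfac b)^-1%:E * rho b f xi = (Gfac a)^-1%:E * rho a f xi)%E).
Proof.
split=> [f Lf fL2 a b a1 ab xi _|c x0 V f c0 VU fE a b a1 ab xi xi1].
  have Lf' := log_concave_rlc Lf.
  rewrite (rho_profile a xi Lf' fL2) (rho_profile b xi Lf' fL2).
  exact: (normalized_radius_nonincreasing (profile_ncov xi Lf' fL2) a1 ab).
have {}fE : f = fun x => c * cone_exp V (x - x0).
  by apply/funext => x; rewrite fE expeR_gauge.
have Lf : rlc f by rewrite fE; exact: rlc_cone_exp.
have fL2 : (0 < L2sq f < +oo)%E by rewrite fE; exact: L2sq_cone_exp.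
pose k := \sum_(i < n) `|(xi *m invmx V) ord0 i|.
(* A point of the sphere is not 0, so its coordinates in the basis of vertices do not all vanish;
   the common radius is then 1/k. *)
have k0 : 0 < k.
  rewrite lt_neqAle eq_sym sumr_ge0 ?andbT//; apply/negP => /eqP k0.
  have xi0 : xi = 0.
    rewrite -[xi]mulmx1 -(mulVmx VU) mulmxA (_ : xi *m invmx V = 0) ?mul0mx//.
    apply/matrixP => i j; rewrite ord1 [RHS]mxE; apply/eqP; rewrite -normr_eq0; apply/eqP.
    by move: k0 => /psumr_eq0P; apply.
  move: xi1; rewrite /sphere/= xi0 big1 => [/eqP|i _]; last by rewrite mxE expr0n.
  by rewrite eq_sym oner_eq0.
have main d : -1 < d -> ((Gfac d)^-1%:E * rho d f xi)%E = (k^-1)%:E.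
  move=> d1; rewrite (rho_profile d xi Lf fL2).
  rewrite (@eq_profile_radius _ _ _ (expdecay k^-1)) => [|t t0].
    by apply: normalized_radius_expdecay; rewrite ?invr_gt0.
  by rewrite fE ncov_cone_exp ?(ltW t0)// /expdecay invrK.
exact: etrans (main b (lt_trans a1 ab)) (esym (main a a1)).
Qed.
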